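(* Under Assumption 1 (stated in the context), there exists a threshold $\bar\beta>0$ such that for every $\beta>\bar\beta$, the problem $\inf_{K\in\mathcal{K}_\beta}J_{\mathrm{mix}}(K)$ admits a stationary point, i.e. there exists $K\in\mathcal{K}_\beta$ with $\nabla J_{\mathrm{mix}}(K)=0$.
   Context: Let $A\in\mathbb{R}^{n\times n}$, $B\in\mathbb{R}^{n\times m}$, $B_w\in\mathbb{R}^{n\times n}$, $W:=B_wB_w^{\mathsf T}$. Let $Q_2\succeq0$, $R_2\succ0$, $Q_\infty\succ0$, $R_\infty\succ0$ be fixed symmetric weight matrices, and let $\beta>0$ be the robustness parameter. For $K\in\mathbb{R}^{m\times n}$ write $A_K:=A+BK$, $S_K:=Q_\infty+K^{\mathsf T}R_\infty K$. Let $\mathcal{K}:=\{K: A_K \text{ Hurwitz}\}$, $\mathbf{T}_\infty(K)(s)=\begin{bmatrix}Q_\infty^{1/2}\\ R_\infty^{1/2}K\end{bmatrix}(sI-A_K)^{-1}B_w$, $\mathcal{K}_\beta:=\{K\in\mathcal{K}:\|\mathbf{T}_\infty(K)\|_{\mathcal{H}_\infty}<\beta\}$. For $K\in\mathcal{K}_\beta$ the Riccati equation $A_KX+XA_K^{\mathsf T}+\beta^{-2}XS_KX+W=0$ has a unique stabilizing solution $X_K\succeq0$ (i.e. $A_K+\beta^{-2}X_KS_K$ Hurwitz), and $J_{\mathrm{mix}}(K):=\operatorname{tr}((Q_2+K^{\mathsf T}R_2K)X_K)$, a differentiable function on the open set $\mathcal{K}_\beta$. Assumption 1: $(A,B)$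 stabilizable, $(Q_2^{1/2},A)$ detectable, and $\beta>\inf_{K\in\mathcal{K}}\|\mathbf{T}_\infty(K)\|_{\mathcal{H}_\infty}$. *)

(* Defs.v *)
From HB Require Import structures.
From mathcomp Require Import all_boot all_order all_algebra.
From mathcomp Require Import complex.
From mathcomp Require Import all_classical all_reals all_analysis.
Set Implicit Arguments. Unset Strict Implicit. Unset Printing Implicit Defensive.
Import Order.TTheory GRing.Theory Num.Theory.
Import numFieldNormedType.Exports.
Local Open Scope classical_set_scope.
Local Open Scope ring_scope.

Section MixedH2Hinf.
Variable R : realType.

Definition toC (x : R) : R[i] := Complex x 0.
Definition mxC (p q : nat) (M : 'M[R]_(p, q)) : 'M[R[i]]_(p, q) := map_mx toC M.

Definition psd (p : nat) (M : 'M[R]_p) : Prop :=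
  M^T = M /\ forall x : 'cV[R]_p, 0 <= (x^T *m M *m x) 0 0.
Definition pd (p : nat) (M : 'M[R]_p) : Prop :=
  M^T = M /\ forall x : 'cV[R]_p, x != 0 -> 0 < (x^T *m M *m x) 0 0.

Definition mx_sqrt (p : nat) (M : 'M[R]_p) : 'M[R]_p :=
  xget 0 [set S : 'M[R]_p | psd S /\ S *m S = M].

Definition hurwitz (p : nat) (M : 'M[R]_p) : Prop :=
  forall z : R[i], eigenvalue (mxC M) z -> complex.Re z < 0.

Definition stabilizable (p q : nat) (A : 'M[R]_p) (B : 'M[R]_(p, q)) : Prop :=
  exists K : 'M[R]_(q, p), hurwitz (A + B *m K).
Definition detectable (p r : nat) (C : 'M[R]_(r, p)) (A : 'M[R]_p) : Prop :=
  exists L : 'M[R]_(p, r), hurwitz (A + L *m C).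

Definition cvnorm (k : nat) (v : 'cV[R[i]]_k) : R :=
  Num.sqrt (\sum_(i < k) ((complex.Re (v i 0)) ^+ 2 + (complex.Im (v i 0)) ^+ 2)).
Definition sigma_max (k l : nat) (M : 'M[R[i]]_(k, l)) : R :=
  sup [set cvnorm (M *m v) | v in [set v : 'cV[R[i]]_l | cvnorm v = 1]].

Variables (n m : nat) (A : 'M[R]_n) (B : 'M[R]_(n, m)) (Bw : 'M[R]_n)
  (Q2 : 'M[R]_n) (R2 : 'M[R]_m) (Qinf : 'M[R]_n) (Rinf : 'M[R]_m).

Definition AK (K : 'M[R]_(m, n)) : 'M[R]_n := A + B *m K.
Definition SK (K : 'M[R]_(m, n)) : 'M[R]_n := Qinf + K^T *m Rinf *m K.
Definition Wmx : 'M[R]_n := Bw *m Bw^T.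

Definition Tinf (K : 'M[R]_(m, n)) (w : R) : 'M[R[i]]_(n + m, n) :=
  mxC (col_mx (mx_sqrt Qinf) (mx_sqrt Rinf *m K))
  *m invmx ((Complex 0 w)%:M - mxC (AK K)) *m mxC Bw.

Definition hinf_norm (K : 'M[R]_(m, n)) : R :=
  sup [set sigma_max (Tinf K w) | w in [set: R]].

Definition Kstab : set 'M[R]_(m, n) := [set K | hurwitz (AK K)].
Definition Kbeta (beta : R) : set 'M[R]_(m, n) :=
  [set K | hurwitz (AK K) /\ hinf_norm K < beta].

Definition riccati (beta : R) (K : 'M[R]_(m, n)) (X : 'M[R]_n) : Prop :=
  AK K *m X + X *m (AK K)^T + beta ^-2 *: (X *m SK K *m X) + Wmx = 0.
Definition stab_sol (beta : R) (K : 'M[R]_(m, n)) (X : 'M[R]_n) : Prop :=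
  psd X /\ riccati beta K X /\ hurwitz (AK K + beta ^-2 *: (X *m SK K)).
Definition XK (beta : R) (K : 'M[R]_(m, n)) : 'M[R]_n :=
  xget 0 (stab_sol beta K).

Definition Jmix (beta : R) (K : 'M[R]_(m, n)) : R :=
  \tr ((Q2 + K^T *m R2 *m K) *m XK beta K).

Definition stationary (beta : R) (K : 'M[R]_(m, n)) : Prop :=
  differentiable (Jmix beta) K /\ forall D : 'M[R]_(m, n), 'd (Jmix beta) K D = 0.

End MixedH2Hinf.

(* Main.v *)
Require Import Defs.
From HB Require Import structures.
From mathcomp Require Import all_boot all_order all_algebra.
From mathcomp Require Import complex ring lra.
From mathcomp Require Import all_classical all_reals all_analysis.
Set Implicit Arguments. Unset Strict Implicit. Unset Printing Implicit Defensive.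
Import Order.TTheory GRing.Theory Num.Theory.
Import numFieldNormedType.Exports.
Local Open Scope classical_set_scope.
Local Open Scope ring_scope.

(** With eps = beta^-2, the gradient of J_mix at K is 2 (R2 K + B' Y + eps Rinf K X Y) X,
    where X = X_K and Y solves the Lyapunov equation Acl' Y + Y Acl + Q2 + K' R2 K = 0 with
    Acl = A_K + eps X S_K. So it suffices to solve the polynomial system formed by the
    Riccati equation for X, the Lyapunov equation for Y and
    R2 K + B' Y + eps Rinf K X Y = 0, without inverting X or assuming W positive.
    At eps = 0 the system decouples: Y is the stabilizing solution of the LQR Riccati
    equation (limit of the Kleinman policy iteration), K = - R2^-1 B' Y, and X solves a
    Lyapunov equation. The linearization there is triangular with invertible diagonal
    blocks, so the implicit function theorem gives solutions near (K, X, Y) for all small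
    eps. The stability and norm constraints hold by openness, since the H-infinity norm is
    bounded near K while beta is large. A second application of the implicit function
    theorem shows that the stabilizing solution X_K' stays within O(|K' - K|) of X, and an
    exact expansion then gives J_mix(K') - J_mix(K) = O(|K' - K|^2). *)

(** * Bilinear forms and matrix norms *)

(* Unlike mxE, these leave the entries of a product folded, as atoms for ring. *)
Section EntryRules.
Variables (R : pzRingType) (p q : nat).
Implicit Types M N : 'M[R]_(p, q).
Lemma mxDE M N i j : (M + N) i j = M i j + N i j. Proof. by rewrite mxE. Qed.
Lemma mxNE M i j : (- M) i j = - M i j. Proof. by rewrite mxE. Qed.
Lemma mxZE a M i j : (a *: M) i j = a * M i j. Proof. by rewrite mxE. Qed.
Lemma mx0E i j : (0 : 'M[R]_(p, q)) i j = 0. Proof. by rewrite mxE. Qed.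
End EntryRules.

Section DistrRules.
Variables (R : pzRingType) (p q : nat).
Lemma trmx_add (M N : 'M[R]_(p, q)) : (M + N)^T = M^T + N^T.
Proof. exact: linearD. Qed.
Lemma trmx_opp (M : 'M[R]_(p, q)) : (- M)^T = - M^T.
Proof. exact: linearN. Qed.
Lemma trmx_scale a (M : 'M[R]_(p, q)) : (a *: M)^T = a *: M^T.
Proof. exact: linearZ. Qed.
End DistrRules.

Ltac mxdistr := rewrite ?(mulmxDl, mulmxDr, mulNmx, mulmxN, trmx_add, trmx_opp,
  trmx_scale, @trmx_mul, trmxK, mulmxA, scalerDr, scalerN, =^~ scalemxAl, =^~ scalemxAr).
Ltac mxentry := apply/matrixP => ? ?; rewrite ?(mxDE, mxNE, mxZE, mx0E).

Lemma unitmx_ker (F : fieldType) p (M : 'M[F]_p) : (forall x : 'cV_p, M *m x = 0 -> x = 0) ->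
  M \in unitmx.
Proof.
move=> h; rewrite -unitmx_tr -row_free_unit -kermx_eq0; apply/eqP/row_matrixP => i.
rewrite row0; apply: trmx_inj; rewrite trmx0; apply: h.
by apply: trmx_inj; rewrite trmx_mul trmxK trmx0 -row_mul mulmx_ker row0.
Qed.

Section Bilinear.
Variable R : realType.

Definition bf p q (M : 'M[R]_(p, q)) (x : 'cV[R]_p) (y : 'cV[R]_q) : R :=
  (x^T *m M *m y) 0 0.
Definition nsq p (x : 'cV[R]_p) : R := (x^T *m x) 0 0.

Lemma bfDl p q (M : 'M[R]_(p, q)) x x' y : bf M (x + x') y = bf M x y + bf M x' y.
Proof. by rewrite /bf linearD /= !mulmxDl mxE. Qed.
Lemma bfDr p q (M : 'M[R]_(p, q)) x y y' : bf M x (y + y') = bf M x y + bf M x y'.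
Proof. by rewrite /bf !mulmxDr mxE. Qed.
Lemma bfZl p q (M : 'M[R]_(p, q)) a x y : bf M (a *: x) y = a * bf M x y.
Proof. by rewrite /bf linearZ /= -!scalemxAl mxE. Qed.
Lemma bfZr p q (M : 'M[R]_(p, q)) a x y : bf M x (a *: y) = a * bf M x y.
Proof. by rewrite /bf -!scalemxAr mxE. Qed.
Lemma bfNl p q (M : 'M[R]_(p, q)) x y : bf M (- x) y = - bf M x y.
Proof. by rewrite -scaleN1r bfZl mulN1r. Qed.
Lemma bfNr p q (M : 'M[R]_(p, q)) x y : bf M x (- y) = - bf M x y.
Proof. by rewrite -scaleN1r bfZr mulN1r. Qed.
Lemma bfDm p q (M N : 'M[R]_(p, q)) x y : bf (M + N) x y = bf M x y + bf N x y.
Proof. by rewrite /bf !(mulmxDr, mulmxDl) mxE. Qed.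
Lemma bfNm p q (M : 'M[R]_(p, q)) x y : bf (- M) x y = - bf M x y.
Proof. by rewrite /bf !(mulmxN, mulNmx) mxE. Qed.
Lemma bfZm p q a (M : 'M[R]_(p, q)) x y : bf (a *: M) x y = a * bf M x y.
Proof. by rewrite /bf -!(scalemxAr, scalemxAl) mxE. Qed.
Lemma bf_tr p q (M : 'M[R]_(p, q)) x y : bf M^T y x = bf M x y.
Proof. by rewrite /bf -[in RHS](trmxK (_ *m y)) [RHS]mxE !trmx_mul trmxK mulmxA. Qed.
Lemma bfMl p q r (N : 'M[R]_(p, q)) (M : 'M[R]_(q, r)) x y :
  bf (N *m M) x y = bf M (N^T *m x) y.
Proof. by rewrite /bf trmx_mul trmxK !mulmxA. Qed.
Lemma bfMr p q r (N : 'M[R]_(p, q)) (M : 'M[R]_(q, r)) x y :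
  bf (N *m M) x y = bf N x (M *m y).
Proof. by rewrite /bf !mulmxA. Qed.
Lemma bf0l p q (M : 'M[R]_(p, q)) y : bf M 0 y = 0.
Proof. by rewrite /bf linear0 !mul0mx mxE. Qed.
Lemma bf1 p (x : 'cV[R]_p) : bf 1%:M x x = nsq x.
Proof. by rewrite /bf mulmx1. Qed.

Lemma nsqE p (x : 'cV[R]_p) : nsq x = \sum_i (x i 0) ^+ 2.
Proof. by rewrite /nsq mxE; apply: eq_bigr => i _; rewrite mxE expr2. Qed.
Lemma nsq_ge0 p (x : 'cV[R]_p) : 0 <= nsq x.
Proof. by rewrite nsqE sumr_ge0 // => i _; rewrite sqr_ge0. Qed.
Lemma nsq_entry p (x : 'cV[R]_p) i : (x i 0) ^+ 2 <= nsq x.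
Proof.
by rewrite nsqE (bigD1 i) //= lerDl sumr_ge0 // => j _; rewrite sqr_ge0.
Qed.
Lemma nsq_eq0 p (x : 'cV[R]_p) : nsq x = 0 -> x = 0.
Proof.
move=> x0; apply/colP => i; rewrite mxE; apply/eqP; rewrite -sqrf_eq0.
by rewrite eq_le sqr_ge0 -x0 nsq_entry.
Qed.
Lemma nsq_gt0 p (x : 'cV[R]_p) : x != 0 -> 0 < nsq x.
Proof.
move=> x0; rewrite lt_neqAle nsq_ge0 andbT; apply: contraNneq x0 => x0.
by apply/eqP/nsq_eq0.
Qed.
Lemma le_entry_norm p q (M : 'M[R]_(p, q)) i j : `|M i j| <= `|M|.
Proof.
rewrite [leRHS]/Num.Def.normr/= mx_normrE.
by apply/bigmax_geP; right; exists (i, j).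
Qed.
Lemma norm_le_entry p q (M : 'M[R]_(p, q)) c :
  0 <= c -> (forall i j, `|M i j| <= c) -> `|M| <= c.
Proof.
move=> c0 h; rewrite [leLHS]/Num.Def.normr/= mx_normrE.
by apply: bigmax_le => // -[i j] _; exact: h.
Qed.
Lemma norm_tr p q (M : 'M[R]_(p, q)) : `|M^T| = `|M|.
Proof.
apply/eqP; rewrite eq_le !norm_le_entry // => i j.
  by rewrite -[M]trmxK mxE trmxK le_entry_norm.
by rewrite mxE le_entry_norm.
Qed.
Lemma norm_mulmx p q r (M : 'M[R]_(p, q)) (N : 'M[R]_(q, r)) :
  `|M *m N| <= q%:R * (`|M| * `|N|).
Proof.
apply: norm_le_entry => [|i j]; first by rewrite !mulr_ge0.
rewrite mxE (le_trans (ler_norm_sum _ _ _)) //.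
rewrite (@le_trans _ _ (\sum_(k < q) `|M| * `|N|)) ?ler_sum// => [k _|].
  by rewrite normrM ler_pM ?le_entry_norm.
by rewrite sumr_const card_ord mulr_natl.
Qed.
Lemma norm_sqr_le_nsq p (x : 'cV[R]_p) : `|x| ^+ 2 <= nsq x.
Proof.
rewrite -[leRHS]sqr_sqrtr ?nsq_ge0//; apply: lerXn2r.
- by rewrite nnegrE.
- by rewrite nnegrE sqrtr_ge0.
apply: norm_le_entry => [|i j]; first exact: sqrtr_ge0.
by rewrite -sqrtr_sqr ler_wsqrtr// (ord1 j) nsq_entry.
Qed.
Lemma nsq_le_norm_sqr p (x : 'cV[R]_p) : nsq x <= p%:R * `|x| ^+ 2.
Proof.
rewrite nsqE (@le_trans _ _ (\sum_(i < p) `|x| ^+ 2)) ?ler_sum// => [i _|].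
  by rewrite -real_normK ?num_real// lerXn2r ?nnegrE ?le_entry_norm.
by rewrite sumr_const card_ord mulr_natl.
Qed.
Lemma bf_le p q (M : 'M[R]_(p, q)) x y :
  `|bf M x y| <= p%:R * q%:R * `|M| * `|x| * `|y|.
Proof.
rewrite /bf (le_trans (le_entry_norm _ _ _)) // (le_trans (norm_mulmx _ _)) //.
have := norm_mulmx x^T M; rewrite norm_tr => h.
rewrite (@le_trans _ _ (q%:R * (p%:R * (`|x| * `|M|) * `|y|))) //.
  by rewrite ler_wpM2l // ler_wpM2r.
by rewrite le_eqVlt; apply/orP; left; apply/eqP; ring.
Qed.
Lemma bf_le_nsq p (M : 'M[R]_p) x : `|bf M x x| <= p%:R ^+ 2 * `|M| * nsq x.
Proof.
rewrite (le_trans (bf_le _ _ _)) // -[leLHS]mulrA -[p%:R * _]expr2 -[_ * `|x|]expr2.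
by rewrite ler_wpM2l ?norm_sqr_le_nsq// mulr_ge0 ?sqr_ge0.
Qed.
Lemma nsq_mulmx p q (M : 'M[R]_(p, q)) x :
  nsq (M *m x) <= p%:R * (q%:R * `|M|) ^+ 2 * nsq x.
Proof.
rewrite (le_trans (nsq_le_norm_sqr _)) // -mulrA ler_wpM2l//.
rewrite (@le_trans _ _ ((q%:R * `|M| * `|x|) ^+ 2)) //.
  by rewrite lerXn2r ?nnegrE ?mulr_ge0// -mulrA norm_mulmx.
by rewrite exprMn ler_wpM2l ?sqr_ge0// norm_sqr_le_nsq.
Qed.

Lemma psdE p (M : 'M[R]_p) : psd M <-> M^T = M /\ forall x, 0 <= bf M x x.
Proof. by []. Qed.
Lemma pdE p (M : 'M[R]_p) : pd M <-> M^T = M /\ forall x, x != 0 -> 0 < bf M x x.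
Proof. by []. Qed.
Lemma pd_psd p (M : 'M[R]_p) : pd M -> psd M.
Proof.
move=> [Ms Mp]; split=> // x; have [->|x0] := eqVneq x 0; last exact: ltW (Mp _ x0).
by rewrite mulmx0 mxE.
Qed.
Lemma psdD p (M N : 'M[R]_p) : psd M -> psd N -> psd (M + N).
Proof.
move=> /psdE[Ms Mp] /psdE[Ns Np]; apply/psdE; split=> [|x].
  by rewrite linearD /= Ms Ns.
by rewrite bfDm addr_ge0.
Qed.
Lemma psdZ p a (M : 'M[R]_p) : 0 <= a -> psd M -> psd (a *: M).
Proof.
move=> a0 /psdE[Ms Mp]; apply/psdE; split=> [|x]; first by rewrite linearZ /= Ms.
by rewrite bfZm mulr_ge0.
Qed.
Lemma psd_congr p q (M : 'M[R]_p) (N : 'M[R]_(q, p)) : psd M -> psd (N *m M *m N^T).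
Proof.
move=> /psdE[Ms Mp]; apply/psdE; split=> [|x].
  by rewrite !trmx_mul trmxK Ms mulmxA.
by rewrite bfMr bfMl.
Qed.
Lemma psd1 p : psd (1%:M : 'M[R]_p).
Proof. by apply/psdE; split=> [|x]; rewrite ?trmx1 ?bf1 ?nsq_ge0. Qed.
Lemma pd1 p : pd (1%:M : 'M[R]_p).
Proof. by apply/pdE; split=> [|x]; rewrite ?trmx1 ?bf1 //; exact: nsq_gt0. Qed.
Lemma psd_gram p q (M : 'M[R]_(p, q)) : psd (M *m M^T).
Proof. by rewrite -[M in M *m _]mulmx1; apply/psd_congr/psd1. Qed.

(** The quadratic polynomial [t |-> bf M (x + t *: y) (x + t *: y)] never becomes negative. As [M]
    is only semidefinite, its leading coefficient may vanish, and that case is treated apart. *)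
Lemma bf_CS p (M : 'M[R]_p) x y : psd M -> bf M x y ^+ 2 <= bf M x x * bf M y y.
Proof.
move=> /psdE[Ms Mp]; have Sxy : bf M y x = bf M x y by rewrite -bf_tr Ms.
have key t : 0 <= bf M x x + 2 * t * bf M x y + t ^+ 2 * bf M y y.
  have := Mp (x + t *: y); rewrite !(bfDl, bfDr, bfZl, bfZr) Sxy.
  by congr (0 <= _); ring.
have c0 := Mp y; have a0 := Mp x.
move: c0; rewrite le_eqVlt => /orP[/eqP c0|c0].
  rewrite -c0 mulr0; have [->|b0] := eqVneq (bf M x y) 0; first by rewrite expr0n.
  (* With zero leading coefficient the polynomial is affine in [t]; at this [t] it would take the
     value -1. *)
  have := key (- (bf M x x + 1) / (2 * bf M x y)).
  rewrite -c0 mulr0 addr0 mulrA.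
  have -> : bf M x x + 2 * - (bf M x x + 1) / (2 * bf M x y) * bf M x y = -1.
    by field.
  by rewrite ler0N1.
(* This is the minimizer of the quadratic. *)
have := key (- bf M x y / bf M y y); rewrite -(pmulr_rge0 _ c0).
have -> : bf M y y * (bf M x x + 2 * (- bf M x y / bf M y y) * bf M x y +
   (- bf M x y / bf M y y) ^+ 2 * bf M y y) = bf M x x * bf M y y - bf M x y ^+ 2.
  by field; rewrite gt_eqF.
by rewrite subr_ge0.
Qed.

(** Cauchy-Schwarz for the pair [M *m x], [x]: the form there equals the squared length of
    [M *m x]. *)
Lemma psd_ker p (M : 'M[R]_p) x : psd M -> bf M x x = 0 -> M *m x = 0.
Proof.
move=> Mp x0; have Ms := Mp.1; apply: nsq_eq0.
have := bf_CS (M *m x) x Mp; rewrite x0 mulr0 => h.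
have : bf M (M *m x) x = 0 by apply/eqP; rewrite -sqrf_eq0 eq_le h sqr_ge0.
by rewrite /bf trmx_mul Ms /nsq trmx_mul Ms !mulmxA.
Qed.

(** Instead of compactness of the sphere, Cauchy-Schwarz is applied to [x] and [invmx M *m x]: it
    bounds [nsq x ^+ 2] by [bf M x x] times a form that is at most a multiple of [nsq x]. *)
Lemma pd_coercive p (M : 'M[R]_p) : pd M ->
  exists2 c, 0 < c & forall x, c * nsq x <= bf M x x.
Proof.
move=> Mpd; have [Ms Mp] := Mpd.
have Mu : M \in unitmx.
  apply: unitmx_ker => x Mx; apply/eqP; apply: contraT => x0.
  by have := Mp _ x0; rewrite -mulmxA Mx mulmx0 mxE ltxx.
pose C := p%:R ^+ 2 * `|invmx M|; have C0 : 0 <= C by rewrite mulr_ge0 ?sqr_ge0.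
exists (C + 1)^-1 => [|x]; first by rewrite invr_gt0 ltr_wpDl.
have [->|x0] := eqVneq x 0; first by rewrite bf0l /nsq mulmx0 mxE mulr0.
have := bf_CS x (invmx M *m x) (pd_psd Mpd).
have -> : bf M x (invmx M *m x) = nsq x.
  by rewrite /bf -mulmxA mulKVmx// .
have -> : bf M (invmx M *m x) (invmx M *m x) = bf (invmx M) x x.
  by rewrite /bf trmx_mul -!mulmxA mulKVmx// trmx_inv Ms.
move=> h; have h2 := le_trans (ler_norm _) (bf_le_nsq (invmx M) x).
have B0 := Mp _ x0; have N0 := nsq_gt0 x0.
rewrite mulrC ler_pdivrMr ?ltr_wpDl//.
have : nsq x * nsq x <= bf M x x * C * nsq x.
  by rewrite -expr2 (le_trans h)// -mulrA ler_wpM2l// ltW.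
rewrite ler_pM2r// => h3; apply: (le_trans h3).
by rewrite ler_wpM2l ?lerDl// ltW.
Qed.

End Bilinear.

(** * Hurwitz matrices and Sylvester equations *)

(* A commutation A X = X B carries over to A - z and B - z; multiplying by all the
   factors of the characteristic polynomial of B annihilates X, whereas each A - z is
   invertible. *)
Lemma intertwine_eq0 (F : closedFieldType) p q (A : 'M[F]_p.+1) (B : 'M[F]_q.+1)
    (X : 'M[F]_(p.+1, q.+1)) :
  (forall z, eigenvalue A z -> eigenvalue B z -> False) ->
  A *m X = X *m B -> X = 0.
Proof.
move=> disj AX.
have [r def_p] := closed_field_poly_normal (char_poly B).
move: def_p; rewrite (monicP (char_poly_monic B)) scale1r => def_p.
have rB z : z \in r -> eigenvalue B z.
  by move=> zr; rewrite eigenvalue_root_char def_p root_prod_XsubC.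
have : X *m horner_mx B (\prod_(z <- r) ('X - z%:P)) = 0.
  by rewrite -def_p Cayley_Hamilton mulmx0.
move: {def_p} X AX rB; elim: r => [|z r ih] X AX rB.
  by rewrite big_nil rmorph1 mulmx1.
rewrite big_cons rmorphM /= mulmxA => h.
have /ih : A *m (X *m horner_mx B ('X - z%:P)) = X *m horner_mx B ('X - z%:P) *m B.
  rewrite mulmxA AX -!mulmxA; congr (_ *m _).
  rewrite rmorphB /= horner_mx_X horner_mx_C.
  have -> : B *m (B - z%:M) = (B - z%:M) *m B.
    by rewrite mulmxBr mulmxBl mul_scalar_mx mul_mx_scalar.
  by [].
move=> /(_ _ h) X'0; have {X'0} AX0 : (A - z%:M) *m X = 0.
  rewrite mulmxBl AX mul_scalar_mx -mul_mx_scalar -mulmxBr -X'0 // => [|w wr].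
    by rewrite rmorphB /= horner_mx_X horner_mx_C.
  by apply: rB; rewrite inE wr orbT.
have Az : A - z%:M \in unitmx.
  rewrite -row_free_unit -kermx_eq0.
  have : ~~ eigenvalue A z by apply/negP => /disj; apply; apply: rB; rewrite inE eqxx.
  by rewrite /eigenvalue /eigenspace negbK.
by rewrite -[X](mulKmx Az) AX0 mulmx0.
Qed.

(** * Complex eigenvectors as pairs of real vectors; uniqueness for Sylvester equations *)

Section ComplexMatrices.
Variable R : realType.

Definition cmx p q (x y : 'M[R]_(p, q)) : 'M[R[i]]_(p, q) :=
  \matrix_(i, j) Complex (x i j) (y i j).

Lemma cmx_split p q (v : 'M[R[i]]_(p, q)) :
  v = cmx (map_mx (@complex.Re R) v) (map_mx (@complex.Im R) v).
Proof. by apply/matrixP => i j; rewrite !mxE; case: (v i j). Qed.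

Lemma cmx_inj p q (x y x' y' : 'M[R]_(p, q)) :
  cmx x y = cmx x' y' -> x = x' /\ y = y'.
Proof.
by move/matrixP => h; split; apply/matrixP => i j; have := h i j; rewrite !mxE => -[].
Qed.

Lemma cmx0 p q : cmx 0 0 = 0 :> 'M[R[i]]_(p, q).
Proof. by apply/matrixP => i j; rewrite !mxE. Qed.

Lemma Complex_sum I (r : seq I) (f g : I -> R) :
  \sum_(i <- r) Complex (f i) (g i) = Complex (\sum_(i <- r) f i) (\sum_(i <- r) g i).
Proof.
by elim: r => [|i r ih]; rewrite ?big_nil// !big_cons ih.
Qed.

Lemma mxC_mul_cmx p q r (M : 'M[R]_(p, q)) (x y : 'M[R]_(q, r)) :
  mxC M *m cmx x y = cmx (M *m x) (M *m y).
Proof.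
apply/matrixP => i j; rewrite !mxE -Complex_sum; apply: eq_bigr => k _.
by rewrite !mxE /toC; simpc.
Qed.

Lemma cmx_mul_mxC p q r (M : 'M[R]_(q, r)) (x y : 'M[R]_(p, q)) :
  cmx x y *m mxC M = cmx (x *m M) (y *m M).
Proof.
apply/matrixP => i j; rewrite !mxE -Complex_sum; apply: eq_bigr => k _.
by rewrite !mxE /toC; simpc.
Qed.

Lemma cmxZ p q a b (x y : 'M[R]_(p, q)) :
  Complex a b *: cmx x y = cmx (a *: x - b *: y) (b *: x + a *: y).
Proof.
apply/matrixP => i j; rewrite !mxE; simpc.
by congr Complex; rewrite addrC.
Qed.

Lemma mxC_cmx p q (M : 'M[R]_(p, q)) : mxC M = cmx M 0.
Proof. by apply/matrixP => i j; rewrite !mxE. Qed.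

Lemma char_poly_tr (F : comNzRingType) p (M : 'M[F]_p) : char_poly M^T = char_poly M.
Proof.
rewrite /char_poly -[RHS]det_tr; congr (\det _); apply/matrixP => i j.
by rewrite !mxE eq_sym.
Qed.

Lemma hurwitz_tr p (M : 'M[R]_p) : hurwitz M -> hurwitz M^T.
Proof.
move=> h z; rewrite eigenvalue_root_char.
have -> : mxC M^T = (mxC M)^T by apply/matrixP => i j; rewrite !mxE.
by rewrite char_poly_tr -eigenvalue_root_char; exact: h.
Qed.

(** Here [x] and [y] are the real and imaginary parts of a left eigenvector for the eigenvalue a +
    ib. All later stability arguments can then stay over the reals. *)
Lemma hurwitz_rowP p (M : 'M[R]_p) : hurwitz M <->
  forall (x y : 'rV[R]_p) a b, x *m M = a *: x - b *: y -> y *m M = b *: x + a *: y ->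
    0 <= a -> x = 0 /\ y = 0.
Proof.
split=> [h x y a b hx hy a0|h z /eigenvalueP[v hv v0]].
  apply: cmx_inj; rewrite cmx0; apply/eqP; apply: contraT => v0.
  suff /h /= : eigenvalue (mxC M) (Complex a b) by rewrite ltNge a0.
  by apply/eigenvalueP; exists (cmx x y) => //; rewrite cmx_mul_mxC cmxZ hx hy.
case: z hv => a b /= hv; rewrite ltNge; apply/negP => a0.
move: hv v0; rewrite [v]cmx_split cmx_mul_mxC cmxZ => /cmx_inj[hx hy].
by have [-> ->] := h _ _ _ _ hx hy a0; rewrite cmx0 eqxx.
Qed.

Lemma hurwitz_colP p (M : 'M[R]_p) : hurwitz M <->
  forall (x y : 'cV[R]_p) a b, M *m x = a *: x - b *: y -> M *m y = b *: x + a *: y ->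
    0 <= a -> x = 0 /\ y = 0.
Proof.
split=> [/hurwitz_tr/hurwitz_rowP h x y a b hx hy a0|h].
  have [||/(congr1 trmx)+/(congr1 trmx)] := h x^T y^T a b _ _ a0.
  - by rewrite -trmx_mul hx linearB !linearZ.
  - by rewrite -trmx_mul hy linearD !linearZ.
  - by rewrite !trmxK !trmx0.
rewrite -[M]trmxK; apply/hurwitz_tr/hurwitz_rowP => x y a b hx hy a0.
have [||/(congr1 trmx)+/(congr1 trmx)] := h x^T y^T a b _ _ a0.
- by rewrite -[M]trmxK -trmx_mul hx linearB !linearZ.
- by rewrite -[M]trmxK -trmx_mul hy linearD !linearZ.
- by rewrite !trmxK !trmx0.
Qed.

(** [X] intertwines [A] with [- B], whose spectra lie in opposite open half planes. Empty dimensions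
    are split off because [intertwine_eq0] needs positive sizes. *)
Lemma sylvester_uniq p q (A : 'M[R]_p) (B : 'M[R]_q) (X : 'M[R]_(p, q)) :
  hurwitz A -> hurwitz B -> A *m X + X *m B = 0 -> X = 0.
Proof.
case: p A X => [|p] A X; first by move=> *; exact: flatmx0.
case: q B X => [|q] B X; first by move=> *; exact: thinmx0.
move=> hA hB /eqP; rewrite addr_eq0 -mulmxN => /eqP AX.
suff : mxC X = 0.
  by rewrite mxC_cmx -cmx0 => /cmx_inj[].
apply: (@intertwine_eq0 _ _ _ (mxC A) (mxC (- B))).
  move=> z /hA z0 /eigenvalueP[v hv v0].
  have /hB : eigenvalue (mxC B) (- z).
    apply/eigenvalueP; exists v => //; rewrite scaleNr -hv.
    have -> : mxC (- B) = - mxC B by apply/matrixP => i j; rewrite !mxE /toC; simpc.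
    by rewrite mulmxN opprK.
  by case: z z0 {hv} => a b /=; rewrite oppr_lt0 => /lt_trans h /h; rewrite ltxx.
by rewrite [mxC X]mxC_cmx mxC_mul_cmx cmx_mul_mxC AX mulmx0 mul0mx.
Qed.

End ComplexMatrices.

(** * Bounded inverses of injective linear maps on matrices *)

Section LinearInverse.
Variable R : realType.

(** In coordinates given by [mxvec], the map is a square matrix with trivial kernel; its inverse
    matrix yields both [g] and the bound. *)
Lemma linear_inj_inv p q (f : 'M[R]_(p, q) -> 'M[R]_(p, q)) :
  linear f -> (forall x, f x = 0 -> x = 0) ->
  exists g : 'M[R]_(p, q) -> 'M[R]_(p, q),
    [/\ forall x, f (g x) = x, forall x, g (f x) = x,
        forall x y, g (x - y) = g x - g y &
        exists2 C, 0 < C & forall x, `|g x| <= C * `|x|].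
Proof.
move=> lf finj.
pose F : {linear 'M[R]_(p, q) -> 'M[R]_(p, q)} :=
  HB.pack f (GRing.isLinear.Build _ _ _ _ f lf).
have Fu : lin_mx F \in unitmx.
  rewrite -row_free_unit -kermx_eq0; apply/eqP/row_matrixP => i; rewrite row0.
  set v := row i _; have : v *m lin_mx F = 0 by rewrite -row_mul mulmx_ker row0.
  rewrite mul_rV_lin => /eqP; rewrite mxvec_eq0 => /eqP /finj /(congr1 mxvec).
  by rewrite vec_mxK linear0.
pose g x : 'M[R]_(p, q) := vec_mx (mxvec x *m invmx (lin_mx F)).
have normv (v : 'rV[R]_(p * q)) : `|vec_mx v| <= `|v|.
  by apply: norm_le_entry => // i j; rewrite mxE le_entry_norm.
have normx (x : 'M[R]_(p, q)) : `|mxvec x| <= `|x|.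
  apply: norm_le_entry => // i j; case/mxvec_indexP: j => k l.
  by rewrite (ord1 i) mxvecE le_entry_norm.
exists g; split=> [x|x|x y|].
- suff : mxvec (F (g x)) = mxvec x by move/(can_inj mxvecK).
  by rewrite -mul_rV_lin mulmxKV.
- rewrite /g; have -> : mxvec (f x) = mxvec x *m lin_mx F by rewrite mul_rV_lin mxvecK.
  by rewrite mulmxK// mxvecK.
- by rewrite /g !linearB /= mulmxBl linearB.
exists ((p * q)%:R * `|invmx (lin_mx F)| + 1); first by rewrite ltr_wpDl ?mulr_ge0.
move=> x; rewrite (le_trans (normv _)) // (le_trans (norm_mulmx _ _)) //.
rewrite [_ * `|invmx _|]mulrC mulrA ler_pM ?mulr_ge0// lerDl//.
Qed.

Lemma linear_sylvester p q (A : 'M[R]_p) (B : 'M[R]_q) :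
  linear (fun X => A *m X + X *m B).
Proof.
move=> a X Y; rewrite mulmxDl mulmxDr -scalemxAl -scalemxAr scalerDr.
by rewrite addrACA.
Qed.

Lemma sylvester_solve p q (A : 'M[R]_p) (B : 'M[R]_q) : hurwitz A -> hurwitz B ->
  (forall N, exists X, A *m X + X *m B = N) /\
  exists2 C, 0 < C & forall X : 'M[R]_(p, q), `|X| <= C * `|A *m X + X *m B|.
Proof.
move=> hA hB; have [|g [gK Kg _ [C C0 gC]]] := linear_inj_inv (linear_sylvester A B).
  by move=> X; exact: sylvester_uniq.
split=> [N|]; first by exists (g N).
by exists C => // X; rewrite -[X in `|X| <= _]Kg.
Qed.

(** The transpose of [X] solves the same equation, so the difference solves the homogeneous one. *)
Lemma lyap_sym p (A X M : 'M[R]_p) : hurwitz A -> M^T = M ->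
  A *m X + X *m A^T = M -> X^T = X.
Proof.
move=> hA Ms AX; apply/eqP; rewrite -subr_eq0; apply/eqP.
apply: (sylvester_uniq hA (hurwitz_tr hA)).
rewrite mulmxBr mulmxBl addrACA -opprD AX -[X in _ - X]Ms -AX linearD /= !trmx_mul trmxK.
by rewrite [X in _ - X]addrC subrr.
Qed.

End LinearInverse.

(** * Lyapunov equations *)

Section Lyapunov.
Variables (R : realType) (n : nat).
Implicit Types A P X M : 'M[R]_n.

(** The controllability form of the Lyapunov operator; the observability form is written
    [lyap A^T]. *)
Definition lyap A X := A *m X + X *m A^T.

Lemma bf_lyap A X x : X^T = X -> bf (lyap A X) x x = 2 * bf X (A^T *m x) x.
Proof.
by move=> Xs; rewrite bfDm bfMl bfMr -[bf X x _]bf_tr Xs mulrDl !mul1r.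
Qed.

Lemma lyap_trP A X : X^T = X -> (lyap A X)^T = lyap A X.
Proof. by move=> Xs; rewrite linearD /= !trmx_mul trmxK Xs addrC. Qed.

Lemma lyapDl A B X : lyap (A + B) X = lyap A X + lyap B X.
Proof. by rewrite /lyap linearD /= mulmxDl mulmxDr addrACA. Qed.

Lemma lyapDr A X Y : lyap A (X + Y) = lyap A X + lyap A Y.
Proof. by rewrite /lyap mulmxDl mulmxDr addrACA. Qed.

Lemma lyapZr A a X : lyap A (a *: X) = a *: lyap A X.
Proof. by rewrite /lyap -scalemxAr -scalemxAl scalerDr. Qed.

Lemma lyapNr A X : lyap A (- X) = - lyap A X.
Proof. by rewrite -scaleN1r lyapZr scaleN1r. Qed.

Lemma lyap_scalar t X : lyap t%:M X = (2 * t) *: X.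
Proof.
by rewrite /lyap tr_scalar_mx mul_scalar_mx mul_mx_scalar -scalerDl mulrDl !mul1r.
Qed.

(** Evaluate the negative form on the two parts of a left eigenvector for a + ib and add: the terms
    in b cancel, leaving 2a times a nonnegative number, which excludes a >= 0. *)
Lemma lyap_hurwitz A P : pd P -> pd (- lyap A P) -> hurwitz A.
Proof.
move=> Ppd [_ Lp]; have [Ps _] := Ppd; have [_ Pge] := pd_psd Ppd.
apply/hurwitz_rowP => x y a b hx hy a0.
have hx' : A^T *m x^T = a *: x^T - b *: y^T.
  by rewrite -trmx_mul hx linearB !linearZ.
have hy' : A^T *m y^T = b *: x^T + a *: y^T.
  by rewrite -trmx_mul hy linearD !linearZ.
have sum_ge0 : 0 <= bf (lyap A P) x^T x^T + bf (lyap A P) y^T y^T.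
  rewrite !bf_lyap// hx' hy' !(bfDl, bfNl, bfZl).
  have -> : bf P y^T x^T = bf P x^T y^T by rewrite -bf_tr Ps.
  have := Pge x^T; have := Pge y^T; rewrite -!/(bf _ _ _) => hPy hPx.
  have := mulr_ge0 a0 hPx; have := mulr_ge0 a0 hPy; lra.
have Lle z : bf (lyap A P) z z <= 0.
  have [->|z0] := eqVneq z 0; first by rewrite bf0l.
  by have := Lp _ z0; rewrite -/(bf _ _ _) bfNm oppr_gt0 => /ltW.
have Llt (z : 'rV[R]_n) : z != 0 -> bf (lyap A P) z^T z^T < 0.
  move=> z0; have := Lp z^T; rewrite -/(bf _ _ _) bfNm oppr_gt0; apply.
  by apply: contraNneq z0 => /(congr1 trmx); rewrite trmxK trmx0 => ->.
split; apply/eqP; apply: contraT => /Llt.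
  by have := Lle y^T; lra.
by have := Lle x^T; lra.
Qed.

(* If mu is the least nonnegative number with X + mu P psd and mu > 0, then X + mu P is
   singular, and on its kernel the Lyapunov operator vanishes although it is negative. *)
Lemma lyap_psd A P X : pd P -> pd (- lyap A P) -> X^T = X -> psd (- lyap A X) -> psd X.
Proof.
move=> Ppd Lpd Xs Mp; have [Ps Pp] := Ppd; have [_ Lp] := Lpd.
have [c c0 hc] := pd_coercive Ppd.
pose S := [set mu : R | 0 <= mu /\ psd (X + mu *: P)].
have S0 : S !=set0.
  (* Coercivity of [P] with constant [c] makes this multiple of [P] dominate the form of [X]. *)
  exists (n%:R ^+ 2 * `|X| / c); split.
    by rewrite mulr_ge0 ?invr_ge0 ?mulr_ge0 ?sqr_ge0// ltW.
  apply/psdE; split=> [|x]; first by rewrite linearD linearZ /= Xs Ps.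
  rewrite bfDm bfZm; have := bf_le_nsq X x; rewrite ler_norml => /andP[+ _].
  have := hc x; rewrite -(ler_pM2l (divr_gt0 ltr01 c0)).
  rewrite mulrA div1r mulVf ?gt_eqF// mul1r => h1 h2.
  have : n%:R ^+ 2 * `|X| * nsq x <= n%:R ^+ 2 * `|X| * (c^-1 * bf P x x).
    by rewrite ler_wpM2l// mulr_ge0 ?sqr_ge0.
  by rewrite [in _ * c^-1 * _]mulrAC mulrA -[_ * c^-1 * _]mulrA; lra.
have lbS : has_lbound S by exists 0 => mu [].
pose mu := inf S.
have mu0 : 0 <= mu by apply: lb_le_inf => // t [].
have Sinf e : 0 < e -> exists2 t, S t & t < mu + e.
  by move=> e0; have [t St lt] := inf_adherent e0 (conj S0 lbS); exists t.
have Np : psd (X + mu *: P).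
  apply/psdE; split=> [|x]; first by rewrite linearD linearZ /= Xs Ps.
  rewrite leNgt; apply/negP => neg.
  have Px : 0 <= bf P x x by have [_] := pd_psd Ppd; apply.
  set b := bf (X + mu *: P) x x in neg.
  (* An element of [S] this close to [mu] would still have a negative form at [x]; the added 1
     avoids division by zero. *)
  have [|t [t0 [_ /(_ x)]]] := Sinf (- b / (bf P x x + 1)).
    by rewrite divr_gt0 ?oppr_gt0 ?ltr_wpDl.
  rewrite -/(bf _ _ _) bfDm bfZm => h1 h2.
  have h3 : t * bf P x x <= (mu - b / (bf P x x + 1)) * bf P x x.
    by rewrite ler_wpM2r// -mulNr ltW.
  have h4 : b / (bf P x x + 1) * (bf P x x + 1) = b by rewrite divfK// gt_eqF ?ltr_wpDl.
  have h5 : b / (bf P x x + 1) < 0 by rewrite pmulr_llt0 ?invr_gt0 ?ltr_wpDl.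
  have h6 : b = bf X x x + mu * bf P x x by rewrite /b bfDm bfZm.
  suff : (0 : R) < 0 by rewrite ltxx.
  lra.
move: mu0; rewrite le_eqVlt => /orP[/eqP mu0|mu0].
  by move: Np; rewrite -mu0 scale0r addr0.
have [Ns Nge] := Np.
have Npd : pd (X + mu *: P).
  apply/pdE; split=> // x x0; rewrite lt_neqAle Nge andbT eq_sym.
  apply/eqP => /(psd_ker Np) Nx.
  have : bf (lyap A (X + mu *: P)) x x = 0.
    by rewrite bf_lyap// /bf -mulmxA Nx mulmx0 mxE mulr0.
  rewrite lyapDr lyapZr bfDm bfZm.
  have := Lp _ x0; have [_ /(_ x)] := Mp; rewrite -!/(bf _ _ _) !bfNm => h1 h2 h3.
  have h4 : 0 < mu * - bf (lyap A P) x x by rewrite mulr_gt0.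
  suff : (0 : R) < 0 by rewrite ltxx.
  lra.
have [d d0 hd] := pd_coercive Npd.
pose D := n%:R ^+ 2 * `|P| + 1; have D0 : 0 < D by rewrite ltr_wpDl ?mulr_ge0 ?sqr_ge0.
(* The bound [d / D] keeps [e *: P] below the coercivity constant of [X + mu *: P], and the bound
   [mu] keeps [mu - e] nonnegative. *)
pose e := Num.min (d / D) mu.
have e0 : 0 < e by rewrite lt_min mu0 divr_gt0.
have : S (mu - e).
  split; first by rewrite subr_ge0 ge_min lexx orbT.
  apply/psdE; split=> [|x]; first by rewrite linearD linearZ /= Xs Ps.
  rewrite scalerBl addrA bfDm bfNm bfZm subr_ge0.
  have h1 : bf P x x <= D * nsq x.
    rewrite (le_trans (ler_norm _))// (le_trans (bf_le_nsq _ _))// ler_wpM2r ?nsq_ge0//.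
    by rewrite lerDl.
  rewrite (le_trans _ (hd x))// (le_trans (ler_wpM2l (ltW e0) h1))// mulrA.
  rewrite ler_wpM2r ?nsq_ge0// -ler_pdivlMr// ge_min lexx//.
by move/(ge_inf lbS); rewrite -/mu leNgt ltrBlDr ltrDl e0.
Qed.

Lemma hurwitz_shift A t : hurwitz A -> 0 <= t -> hurwitz (A - t%:M).
Proof.
move=> /hurwitz_rowP hA t0; apply/hurwitz_rowP => x y a b hx hy a0.
apply: (hA x y (a + t) b); last exact: addr_ge0.
  by move: hx; rewrite mulmxBr mul_mx_scalar => /eqP; rewrite subr_eq => /eqP ->;
     rewrite scalerDl addrAC.
by move: hy; rewrite mulmxBr mul_mx_scalar => /eqP; rewrite subr_eq => /eqP ->;
   rewrite scalerDl addrA.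
Qed.

Lemma norm_scalar_mx (a : R) : `|a%:M : 'M[R]_n| <= `|a|.
Proof.
apply: norm_le_entry => // i j; rewrite mxE; case: (i == j) => //=.
by rewrite mulr0n normr0.
Qed.

(* Continuation in t for the matrices A - t: for t large the identity is a solution,
   and the set of good t is stable under decreasing t by a uniform amount. *)
Lemma lyap_exists A : hurwitz A -> exists2 P, pd P & pd (- lyap A P).
Proof.
move=> hA.
pose T := [set t : R | 0 <= t /\ exists2 P, pd P & pd (- lyap (A - t%:M) P)].
have A0 : A - (0 : R)%:M = A.
  by apply/matrixP => i j; rewrite !mxE mul0rn subr0.
suff [_ [P Pp LP]] : T 0 by exists P => //; rewrite A0 in LP.
have T0 : T !=set0.
  pose D := n%:R ^+ 2 * `|lyap A 1%:M|; have D0 : 0 <= D by rewrite mulr_ge0 ?sqr_ge0.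
  exists (D + 1); split; first exact: addr_ge0.
  exists 1%:M; first exact: pd1.
  apply/pdE; split=> [|x x0]; first by rewrite linearN /= lyap_trP ?trmx1.
  rewrite lyapDl -[- (_)%:M]scaleN1r scale_scalar_mx lyap_scalar bfNm bfDm bfZm bf1.
  have := le_trans (ler_norm _) (bf_le_nsq (lyap A 1%:M) x); rewrite -/D.
  have := nsq_gt0 x0; have := mulr_ge0 D0 (nsq_ge0 x); lra.
have lbT : has_lbound T by exists 0 => t [].
pose t0 := inf T.
have t00 : 0 <= t0 by apply: lb_le_inf => // t [].
(* The constant is taken at the infimum [t0], where the inverse of the Lyapunov operator is bounded;
   the step length [d] below depends on [n] and [C] only. *)
have [_ [C C0 hC]] := sylvester_solve (hurwitz_shift hA t00) (hurwitz_tr (hurwitz_shift hA t00)).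
pose N : R := n%:R ^+ 2; have N0 : 0 <= N by rewrite sqr_ge0.
pose d := (8 * ((N + 1) * (C + 1)))^-1.
have d0 : 0 < d by rewrite invr_gt0 !mulr_gt0// ltr_wpDl// ltW.
have hd : 8 * ((N + 1) * (C + 1)) * d = 1.
  by rewrite mulfV// gt_eqF// !mulr_gt0// ltr_wpDl// ltW.
have hdC : 4 * (d * C) <= 1.
  have := mulr_ge0 (mulr_ge0 N0 (ltW C0)) (ltW d0); have := mulr_ge0 N0 (ltW d0).
  have := mulr_ge0 (ltW C0) (ltW d0); have := d0; move: hd.
  rewrite !(mulrDl, mulrDr, mul1r, mulr1, mulrA); lra.
have [t [t_ge0 [P Pp LPp]] tlt] := inf_adherent d0 (conj T0 lbT).
have t0t : t0 <= t by apply: (ge_inf lbT); split=> //; exists P.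
have htS := hurwitz_shift hA t_ge0.
have [/(_ (- 1%:M))[Q hQ] _] := sylvester_solve htS (hurwitz_tr htS).
have Qs : Q^T = Q.
  by apply: (lyap_sym htS _ hQ); rewrite linearN /= trmx1.
have Qpsd : psd Q.
  by apply: (lyap_psd Pp LPp) => //; rewrite /lyap hQ opprK; exact: psd1.
have LQ s : lyap (A - s%:M) Q = - 1%:M + (2 * (t - s)) *: Q.
  have -> : A - s%:M = (A - t%:M) + (t - s)%:M.
    by apply/matrixP => i j; rewrite !mxE mulrnBl; ring.
  by rewrite lyapDl {1}/lyap hQ lyap_scalar.
have Qpd : pd Q.
  apply/pdE; split=> // x x0; rewrite lt_neqAle Qpsd.2 andbT eq_sym.
  apply/eqP => /(psd_ker Qpsd) Qx.
  have : bf (lyap (A - t%:M) Q) x x = 0.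
    by rewrite bf_lyap// /bf -mulmxA Qx mulmx0 mxE mulr0.
  rewrite LQ subrr mulr0 scale0r addr0 bfNm bf1.
  by have := nsq_gt0 x0 => /[swap] /eqP; rewrite oppr_eq0 => /eqP ->; rewrite ltxx.
(* At [t0] the equation for [Q] has the extra term [(2 * (t - t0)) *: Q] with [t - t0 < d], and
   [hdC] absorbs it into half of the left side. *)
have Qn : `|Q| <= 2 * C.
  have := hC Q; rewrite -[_ + _]/(lyap _ Q) LQ.
  have h1 : `|- (1%:M : 'M[R]_n) + (2 * (t - t0)) *: Q| <= 1 + 2 * d * `|Q|.
    rewrite (le_trans (ler_normD _ _))// normrN lerD//.
      by rewrite (le_trans (norm_scalar_mx _))// normr1.
    rewrite normrZ ler_wpM2r// ger0_norm ?mulr_ge0 ?subr_ge0//; move: tlt; rewrite -/t0; lra.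
  move=> /le_trans /(_ (ler_wpM2l (ltW C0) h1)) h2.
  have := ler_wpM2r (normr_ge0 Q) hdC; move: h2.
  rewrite !(mulrDl, mulrDr, mul1r, mulr1, mulrA); lra.
(* Once [s] belongs to [T], the infimum forces [t0 <= s], which is possible only if the clipping at
   0 is active. *)
pose s := Num.max 0 (t0 - d).
have Ts : T s.
  split; first by rewrite le_max lexx.
  exists Q; first exact: Qpd.
  apply/pdE; split=> [|x x0]; first by rewrite trmx_opp lyap_trP.
  rewrite LQ opprD opprK bfDm bf1 bfNm bfZm subr_gt0.
  have h1 := le_trans (ler_norm _) (bf_le_nsq Q x).
  have h2 : t0 - d <= s by rewrite le_max lexx orbT.
  have h2' : s <= t by rewrite ge_max t_ge0 /=; move: t0t d0; lra.
  have Q0 : 0 <= bf Q x x by have [_] := Qpsd; apply.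
  have h3 : 2 * (t - s) * bf Q x x <= 4 * d * (N * (2 * C) * nsq x).
    rewrite ler_pM ?mulr_ge0 ?subr_ge0//.
      by move: tlt; rewrite -/t0; lra.
    by rewrite (le_trans h1)// ler_wpM2r ?nsq_ge0// ler_wpM2l.
  rewrite (le_lt_trans h3)//.
  have -> : 4 * d * (N * (2 * C) * nsq x) = 8 * (N * C) * d * nsq x by ring.
  rewrite -[ltRHS]mul1r ltr_pM2r ?nsq_gt0// -[ltRHS]hd.
  have := mulr_ge0 N0 (ltW d0); have := mulr_ge0 (ltW C0) (ltW d0); have := d0.
  by rewrite !(mulrDl, mulrDr, mul1r, mulr1, mulrA); lra.
suff -> : 0 = s by [].
have : t0 <= s := ge_inf lbT Ts.
by rewrite /s; have [_|h1 h2] := leP (t0 - d) 0 => //; move: d0 h1 h2; lra.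
Qed.

Lemma hurwitz_lyap_psd A X M : hurwitz A -> psd M -> lyap A X = - M -> psd X.
Proof.
move=> hA Mp hX; have [P Pp LP] := lyap_exists hA.
apply: (lyap_psd Pp LP); last by rewrite hX opprK.
by apply: (lyap_sym hA _ hX); rewrite linearN /= Mp.1.
Qed.

(** [lyap] is linear in its first argument, so one [P] certifies stability on a whole ball: half of
    the coercivity constant pays for the perturbation. *)
Lemma hurwitz_robust A : hurwitz A -> exists P c d, [/\ pd P, 0 < c, 0 < d &
  forall M, `|M - A| <= d -> forall x, bf (lyap M P) x x <= - c * nsq x].
Proof.
move=> hA; have [P Pp LP] := lyap_exists hA.
have [c c0 hc] := pd_coercive LP.
pose D := n%:R ^+ 2 * (2 * (n%:R * `|P|)) + 1.
have D0 : 0 < D by rewrite ltr_wpDl// !mulr_ge0 ?sqr_ge0.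
exists P, (c / 2), (c / 2 / D); split=> //.
- by rewrite divr_gt0.
- by rewrite !divr_gt0.
move=> M MA x; rewrite -[M](subrK A) lyapDl bfDm.
have := hc x; rewrite bfNm => h1.
have h2 := le_trans (ler_norm _) (bf_le_nsq (lyap (M - A) P) x).
have h3 : `|lyap (M - A) P| <= 2 * (n%:R * `|P|) * `|M - A|.
  rewrite (le_trans (ler_normD _ _))//.
  have := norm_mulmx (M - A) P; have := norm_mulmx P (M - A)^T; rewrite norm_tr; lra.
have h4 : n%:R ^+ 2 * `|lyap (M - A) P| <= c / 2.
  rewrite (le_trans (ler_wpM2l (sqr_ge0 _) h3))// [leLHS]mulrA.
  rewrite (@le_trans _ _ (D * (c / 2 / D)))//.
    by apply: ler_pM => //; rewrite /D ?lerDl// !mulr_ge0.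
  by rewrite mulrC divfK// gt_eqF.
have := ler_wpM2r (nsq_ge0 x) h4; lra.
Qed.

Lemma hurwitz_open A : hurwitz A -> exists2 d, 0 < d &
  forall M, `|M - A| <= d -> hurwitz M.
Proof.
move=> /hurwitz_robust[P [c [d [Pp c0 d0 h]]]]; exists d => // M /h Mx.
apply: (lyap_hurwitz Pp); apply/pdE; split=> [|x x0].
  by rewrite linearN /= lyap_trP// Pp.1.
rewrite bfNm oppr_gt0 (le_lt_trans (Mx x))// mulNr oppr_lt0 mulr_gt0//.
exact: nsq_gt0.
Qed.

End Lyapunov.

(** * The LQR Riccati equation *)

Section MatrixLimits.
Variable R : realType.

Definition mxcvg p q (u : nat -> 'M[R]_(p, q)) (l : 'M[R]_(p, q)) :=
  forall i j, (fun k => u k i j) @ \oo --> l i j.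

Lemma mxcvg_cst p q (M : 'M[R]_(p, q)) : mxcvg (fun=> M) M.
Proof. by move=> i j; exact: cvg_cst. Qed.
Arguments mxcvg_cst {p q} M.

Lemma mxcvgD p q (u v : nat -> 'M[R]_(p, q)) l m :
  mxcvg u l -> mxcvg v m -> mxcvg (fun k => u k + v k) (l + m).
Proof.
move=> ul vm i j; rewrite mxE; under eq_fun do rewrite mxE.
by apply: cvgD.
Qed.

Lemma mxcvgM p q r (u : nat -> 'M[R]_(p, q)) (v : nat -> 'M[R]_(q, r)) l m :
  mxcvg u l -> mxcvg v m -> mxcvg (fun k => u k *m v k) (l *m m).
Proof.
move=> ul vm i j; rewrite mxE; under eq_fun do rewrite mxE.
by apply: cvg_big => [|k _]; [exact: add_continuous|apply: cvgM].
Qed.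

Lemma mxcvg_tr p q (u : nat -> 'M[R]_(p, q)) l :
  mxcvg u l -> mxcvg (fun k => (u k)^T) l^T.
Proof.
by move=> ul i j; rewrite mxE; under eq_fun do rewrite mxE; exact: ul.
Qed.

Lemma mxcvg_shift p q (u : nat -> 'M[R]_(p, q)) l :
  mxcvg u l -> mxcvg (fun k => u k.+1) l.
Proof. by move=> ul i j; rewrite (cvg_shiftS (fun k => u k i j)). Qed.

Lemma mxcvg_uniq p q (u : nat -> 'M[R]_(p, q)) l m : mxcvg u l -> mxcvg u m -> l = m.
Proof.
by move=> ul um; apply/matrixP => i j; apply: (cvg_unique _ (ul i j) (um i j)).
Qed.

Lemma bf_delta p (M : 'M[R]_p) i j : bf M (delta_mx i 0) (delta_mx j 0) = M i j.
Proof. by rewrite /bf trmx_delta -rowE -colE !mxE. Qed.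

(** Each quadratic form decreases and is bounded below; polarization on basis vectors carries the
    convergence over to the entries. *)
Lemma psd_decreasing_cvg p (Y : nat -> 'M[R]_p) :
  (forall k, psd (Y k)) -> (forall k, psd (Y k - Y k.+1)) ->
  exists2 l, psd l & mxcvg Y l.
Proof.
move=> Yp Yd.
have qcvg x : cvg ((fun k => bf (Y k) x x) @ \oo).
  apply: nonincreasing_is_cvgn.
    apply/nonincreasing_seqP => k; have /psdE[_ /(_ x)] := Yd k.
    by rewrite bfDm bfNm subr_ge0.
  by exists 0 => _ [k _ <-]; have /psdE[_] := Yp k; apply.
pose d i : 'cV[R]_p := delta_mx i 0.
have Yij k i j : Y k i j = 2^-1 * (bf (Y k) (d i + d j) (d i + d j)
    - bf (Y k) (d i) (d i) - bf (Y k) (d j) (d j)).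
  rewrite !(bfDl, bfDr) !bf_delta.
  have -> : Y k j i = Y k i j by rewrite -[in LHS](Yp k).1 mxE.
  lra.
pose l := \matrix_(i, j) lim ((fun k => Y k i j) @ \oo).
have Yl : mxcvg Y l.
  move=> i j; rewrite mxE; suff : cvg ((fun k => Y k i j) @ \oo) by [].
  under eq_fun do rewrite Yij.
  by apply: is_cvgMr; apply: is_cvgB; [apply: is_cvgB|]; exact: qcvg.
exists l => //; apply/psdE; split=> [|x].
  apply: (mxcvg_uniq (mxcvg_tr Yl)); under eq_fun do rewrite (Yp _).1.
  exact: Yl.
have /(_ 0 0) := mxcvgM (mxcvgM (mxcvg_cst x^T) Yl) (mxcvg_cst x).
move=> h; rewrite /bf -(cvg_lim _ h)//; apply: limr_ge; first by apply/cvg_ex; exists (bf l x x).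
by apply: nearW => k; have /psdE[_] := Yp k; apply.
Qed.

End MatrixLimits.
Arguments mxcvg_cst {R p q} M.

(** * Kleinman policy iteration *)

Section LQR.
Variables (R : realType) (n m : nat) (A : 'M[R]_n) (B : 'M[R]_(n, m)).
Variables (Q2 : 'M[R]_n) (R2 : 'M[R]_m).
Hypotheses (Q2psd : psd Q2) (R2pd : pd R2).
Hypotheses (stab : stabilizable A B) (detect : detectable (mx_sqrt Q2) A).

(** A vector in the kernel of [Q2] is also in the kernel of its square root, so an unstable
    eigenvector of [A] there survives every output injection [L]. *)
Lemma detectable_eigen (x y : 'cV[R]_n) a b :
  A *m x = a *: x - b *: y -> A *m y = b *: x + a *: y -> 0 <= a ->
  Q2 *m x = 0 -> Q2 *m y = 0 -> x = 0 /\ y = 0.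
Proof.
move=> hx hy a0 Qx Qy.
have ker (z : 'cV[R]_n) : Q2 *m z = 0 -> mx_sqrt Q2 *m z = 0.
  (* In the default branch of [xget] the root is 0 and the claim is immediate. *)
  rewrite /mx_sqrt; case: xgetP => [S _ [[Ss _] SS]|_] Qz; last exact: mul0mx.
  apply: nsq_eq0; rewrite /nsq trmx_mul Ss -mulmxA [S *m (S *m z)]mulmxA SS Qz.
  by rewrite mulmx0 mxE.
have [L /hurwitz_colP hL] := detect; apply: (hL x y a b) => //.
  by rewrite mulmxDl -mulmxA ker// mulmx0 addr0.
by rewrite mulmxDl -mulmxA ker// mulmx0 addr0.
Qed.

(** On an unstable eigenvector the left side of the equation is nonnegative and the right side
    nonpositive. All cost terms therefore vanish, the input [K *m x] is 0, and detectability
    applies. The slack [N] is what policy improvement produces. *)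
Lemma cost_hurwitz (K : 'M[R]_(m, n)) (Y N : 'M[R]_n) : psd Y -> psd N ->
  lyap (A + B *m K)^T Y = - (Q2 + K^T *m R2 *m K + N) -> hurwitz (A + B *m K).
Proof.
move=> Yp Np hY; apply/hurwitz_colP => x y a b hx hy a0.
have Y0 z : 0 <= bf Y z z by have /psdE[_] := Yp; apply.
have Q0 z : 0 <= bf Q2 z z by have /psdE[_] := Q2psd; apply.
have N0 z : 0 <= bf N z z by have /psdE[_] := Np; apply.
have R0 z : 0 <= bf R2 z z by have /psdE[_] := pd_psd R2pd; apply.
have Ys := Yp.1.
have e z : 2 * bf Y ((A + B *m K) *m z) z =
    - (bf Q2 z z + bf R2 (K *m z) (K *m z) + bf N z z).
  rewrite -[A + B *m K]trmxK -bf_lyap// hY bfNm !bfDm.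
  by rewrite bfMr bfMl trmxK.
have Syx : bf Y y x = bf Y x y by rewrite -bf_tr Ys.
have ex := e x; have ey := e y.
move: ex ey; rewrite hx hy !(bfDl, bfNl, bfZl) Syx => ex ey.
have p1 := mulr_ge0 a0 (Y0 x); have p2 := mulr_ge0 a0 (Y0 y).
have q1 := Q0 x; have q2 := Q0 y; have n1 := N0 x; have n2 := N0 y.
have r1 := R0 (K *m x); have r2 := R0 (K *m y).
have Qx : bf Q2 x x = 0 by lra.
have Qy : bf Q2 y y = 0 by lra.
have Rx : bf R2 (K *m x) (K *m x) = 0 by lra.
have Ry : bf R2 (K *m y) (K *m y) = 0 by lra.
have ker z : bf R2 z z = 0 -> z = 0.
  move=> Rz; apply/eqP; apply: contraT => z0.
  by have := R2pd.2 _ z0; rewrite -/(bf _ _ _) Rz ltxx.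
apply: (@detectable_eigen x y a b _ _ a0 (psd_ker Q2psd Qx) (psd_ker Q2psd Qy)).
  by rewrite -hx mulmxDl -mulmxA (ker _ Rx) mulmx0 addr0.
by rewrite -hy mulmxDl -mulmxA (ker _ Ry) mulmx0 addr0.
Qed.

Lemma R2_unit : R2 \in unitmx.
Proof.
apply: unitmx_ker => x Rx; apply/eqP; apply: contraT => x0.
by have := R2pd.2 _ x0; rewrite -mulmxA Rx mulmx0 mxE ltxx.
Qed.

(** The invariant of the iteration: a stabilizing gain with its cost matrix. *)
Let admissible (p : 'M[R]_(m, n) * 'M[R]_n) := [/\ hurwitz (A + B *m p.1), psd p.2 &
  lyap (A + B *m p.1)^T p.2 = - (Q2 + p.1^T *m R2 *m p.1)].

Lemma cost_psd (K : 'M[R]_(m, n)) : psd (Q2 + K^T *m R2 *m K).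
Proof.
by apply: psdD => //; have := psd_congr K^T (pd_psd R2pd); rewrite trmxK.
Qed.

Lemma admissible_ex K : hurwitz (A + B *m K) -> exists Y, admissible (K, Y).
Proof.
move=> hK; have hKt := hurwitz_tr hK.
have [/(_ (- (Q2 + K^T *m R2 *m K)))[Y hY] _] := sylvester_solve hKt (hurwitz_tr hKt).
by exists Y; split=> //=; apply: (hurwitz_lyap_psd hKt _ hY); exact: cost_psd.
Qed.

(** Completing the square shows that the old cost [Y] solves the Lyapunov equation of the new gain
    with an extra semidefinite term. That term yields both stability of the new gain and the
    decrease of the cost. *)
Lemma kleinman_step p : admissible p -> exists2 p', admissible p' &
  p'.1 = - (invmx R2 *m B^T *m p.2) /\ psd (p.2 - p'.2).
Proof.
case: p => K Y [/= hK Yp hY].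
have [K' defK'] : exists K' : 'M[R]_(m, n), K' = - (invmx R2 *m B^T *m Y) by eexists.
have RK : B^T *m Y = - (R2 *m K').
  by rewrite defK' mulmxN opprK !mulmxA mulmxV ?R2_unit// mul1mx.
have KR : Y *m B = - (K'^T *m R2).
  by rewrite -[LHS]trmxK trmx_mul Yp.1 RK linearN /= trmx_mul R2pd.1.
have hY' : lyap (A + B *m K')^T Y =
    - (Q2 + K'^T *m R2 *m K' + (K - K')^T *m R2 *m (K - K')).
  move: hY; rewrite /lyap.
  mxdistr.
  rewrite -![_ *m B^T *m Y]mulmxA !RK !KR ?mulmxN ?mulNmx ?mulmxA.
  move=> /matrixP h; apply/matrixP => i j; move: (h i j).
  rewrite ?(mxDE, mxNE, mxZE, mx0E); lra.
have DR : psd ((K - K')^T *m R2 *m (K - K')).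
  by have := psd_congr (K - K')^T (pd_psd R2pd); rewrite trmxK.
have hK' := cost_hurwitz Yp DR hY'.
have [Y' aY'] := admissible_ex hK'; exists (K', Y') => //; split=> //=.
have [_ _ /= hY1] := aY'.
apply: (hurwitz_lyap_psd (hurwitz_tr hK') DR).
by rewrite lyapDr lyapNr hY' hY1 opprK [- (_ + _ + _)]opprD addrAC addNr add0r.
Qed.

Lemma lqr_riccati : exists K Y, [/\ hurwitz (A + B *m K), Y^T = Y,
  B^T *m Y = - (R2 *m K) & lyap (A + B *m K)^T Y = - (Q2 + K^T *m R2 *m K)].
Proof.
have [K0 /admissible_ex[Y0 a0]] := stab.
(* Choosing successors on the type of admissible pairs lets the iteration carry its invariant. *)
have [|f hf] := @boolp.choice _ _ (fun p p' : {p | admissible p} =>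
    (sval p').1 = - (invmx R2 *m B^T *m (sval p).2) /\
    psd ((sval p).2 - (sval p').2)).
  by move=> [p ap] /=; have [p' ap' hp] := kleinman_step ap; exists (exist _ p' ap').
pose s k := sval (iter k f (exist _ _ a0)).
have sa k : admissible (s k) by rewrite /s; case: (iter k _ _).
have s1 k : (s k.+1).1 = - (invmx R2 *m B^T *m (s k).2) by exact: (hf _).1.
have s2 k : psd ((s k).2 - (s k.+1).2) by exact: (hf _).2.
have [Y Yp cY] : exists2 Y, psd Y & mxcvg (fun k => (s k).2) Y.
  by apply: psd_decreasing_cvg => // k; have [] := sa k.
pose K := - (invmx R2 *m B^T *m Y).
have cK : mxcvg (fun k => (s k.+1).1) K.
  under eq_fun do rewrite s1 -mulNmx.
  by rewrite /K -mulNmx; apply: mxcvgM cY; exact: mxcvg_cst.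
have hY : lyap (A + B *m K)^T Y + (Q2 + K^T *m R2 *m K) = 0.
  have c1 : mxcvg (fun k => A + B *m (s k.+1).1) (A + B *m K).
    by apply: mxcvgD; [exact: mxcvg_cst|apply: mxcvgM => //; exact: mxcvg_cst].
  have c2 := mxcvg_tr c1; have c3 := mxcvg_shift cY.
  have c4 := mxcvgD (mxcvgM c2 c3) (mxcvgM c3 (mxcvg_tr c2)).
  have c5 := mxcvgM (mxcvgM (mxcvg_tr cK) (mxcvg_cst R2)) cK.
  have c6 := mxcvgD c4 (mxcvgD (mxcvg_cst Q2) c5).
  apply: (mxcvg_uniq c6); move=> i j.
  have -> : (fun k => (lyap (A + B *m (s k.+1).1)^T (s k.+1).2 +
      (Q2 + (s k.+1).1^T *m R2 *m (s k.+1).1)) i j) = fun=> (0 : 'M[R]_n) i j.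
    by apply/funext => k; have [_ _ ->] := sa k.+1; rewrite addNr.
  exact: cvg_cst.
have hY' : lyap (A + B *m K)^T Y = - (Q2 + K^T *m R2 *m K).
  by apply/eqP; rewrite -addr_eq0 hY.
exists K, Y; split=> //; last 1 first.
- by rewrite mulmxN opprK !mulmxA mulmxV ?R2_unit// mul1mx.
(* The Hurwitz property is not closed under limits, so it is recovered from the limit equation
   through detectability. *)
- apply: (@cost_hurwitz K Y 0) => //; last by rewrite addr0.
  by rewrite -(scale0r (1%:M : 'M[R]_n)); apply: psdZ => //; exact: psd1.
- exact: Yp.1.
Qed.

End LQR.

(** * Implicit functions *)

(** Completeness of matrix spaces, on which the Banach fixed-point theorem relies. *)
HB.instance Definition _ (R : realType) p q := Complete.on (matrix R p q).

Section StrictDifferentiability.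
Variables (R : realType) (T : Type) (F : set_system T) (FF : Filter F).
Variables (p q : nat) (z0 : 'M[R]_(p, q)).
Let V := 'M[R]_(p, q).

(* Strict differentiability in z at z0, uniformly in a parameter t tending along F. *)
Definition sdiff k l (f : T -> V -> 'M[R]_(k, l)) (f0 : 'M[R]_(k, l))
    (L : V -> 'M[R]_(k, l)) :=
  (exists2 C, 0 <= C & forall h, `|L h| <= C * `|h|) /\
  forall e, 0 < e -> exists2 d, 0 < d & \forall t \near F, forall z z',
    `|z - z0| <= d -> `|z' - z0| <= d ->
    `|f t z - f0| <= e /\ `|f t z - f t z' - L (z - z')| <= e * `|z - z'|.

Lemma sdiff_param k l (a : T -> 'M[R]_(k, l)) a0 :
  (forall e, 0 < e -> \forall t \near F, `|a t - a0| <= e) ->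
  sdiff (fun t _ => a t) a0 (fun=> 0).
Proof.
move=> ha; split; first by exists 0 => // h; rewrite normr0 mul0r.
move=> e e0; exists 1 => //; apply: filterS (ha _ e0) => t ht z z' _ _; split=> //.
by rewrite subrr subr0 normr0 mulr_ge0 ?(ltW e0).
Qed.

Lemma sdiff_cst k l (c : 'M[R]_(k, l)) : sdiff (fun _ _ => c) c (fun=> 0).
Proof.
by apply: sdiff_param => e e0; apply: nearW => t; rewrite subrr normr0 ltW.
Qed.

Lemma sdiff_lin k l (L : V -> 'M[R]_(k, l)) :
  (forall z z', L (z - z') = L z - L z') -> (forall h, `|L h| <= `|h|) ->
  sdiff (fun _ z => L z) (L z0) L.
Proof.
move=> LB Lb; split; first by exists 1 => // h; rewrite mul1r.
move=> e e0; exists e => //; apply: nearW => t z z' hz hz'; split.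
  by rewrite -LB (le_trans (Lb _)).
by rewrite -LB subrr normr0 mulr_ge0 ?(ltW e0).
Qed.

Lemma sdiff_tr k l (f : T -> V -> 'M[R]_(k, l)) f0 L :
  sdiff f f0 L -> sdiff (fun t z => (f t z)^T) f0^T (fun h => (L h)^T).
Proof.
move=> [[C C0 hC] hf]; split; first by exists C => // h; rewrite norm_tr.
move=> e e0; have [d d0 fd] := hf e e0; exists d => //.
apply: filterS fd => t ht z z' hz hz'; have [h1 h2] := ht z z' hz hz'.
by rewrite -!raddfB /= !norm_tr.
Qed.

Lemma sdiff_near2 k l k' l' (f : T -> V -> 'M[R]_(k, l)) f0 L
    (g : T -> V -> 'M[R]_(k', l')) g0 M e :
  sdiff f f0 L -> sdiff g g0 M -> 0 < e ->
  exists2 d, 0 < d & \forall t \near F, forall z z',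
    `|z - z0| <= d -> `|z' - z0| <= d ->
    (`|f t z - f0| <= e /\ `|f t z - f t z' - L (z - z')| <= e * `|z - z'|) /\
    (`|g t z - g0| <= e /\ `|g t z - g t z' - M (z - z')| <= e * `|z - z'|).
Proof.
move=> [_ hf] [_ hg] e0.
have [d d0 fd] := hf _ e0; have [d' d'0 gd] := hg _ e0.
exists (Num.min d d'); first by rewrite lt_min d0.
apply: filterS2 fd gd => t ft gt z z'; rewrite !le_min => /andP[a b] /andP[a' b'].
by split; [apply: ft|apply: gt].
Qed.

Lemma sdiffD k l (f g : T -> V -> 'M[R]_(k, l)) f0 g0 L M :
  sdiff f f0 L -> sdiff g g0 M ->
  sdiff (fun t z => f t z + g t z) (f0 + g0) (fun h => L h + M h).
Proof.
move=> sf sg; split.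
  have [[C C0 hC] _] := sf; have [[D D0 hD] _] := sg.
  exists (C + D) => [|h]; first exact: addr_ge0.
  by rewrite (le_trans (ler_normD _ _))// mulrDl lerD.
move=> e e0; have [d d0 h] := sdiff_near2 sf sg (divr_gt0 e0 (ltr0n R 2)).
exists d => //; apply: filterS h => t ht z z' hz hz'.
have [[h1 h2] [h3 h4]] := ht z z' hz hz'; split.
  rewrite opprD addrACA (le_trans (ler_normD _ _))//; lra.
have -> : f t z + g t z - (f t z' + g t z') - (L (z - z') + M (z - z')) =
  (f t z - f t z' - L (z - z')) + (g t z - g t z' - M (z - z')).
  by mxentry; ring.
by rewrite (le_trans (ler_normD _ _))//; lra.
Qed.

Lemma sdiffM k l r (f : T -> V -> 'M[R]_(k, l)) (g : T -> V -> 'M[R]_(l, r)) f0 g0 L M :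
  sdiff f f0 L -> sdiff g g0 M ->
  sdiff (fun t z => f t z *m g t z) (f0 *m g0) (fun h => L h *m g0 + f0 *m M h).
Proof.
move=> sf sg; have [[C C0 hC] _] := sf; have [[D D0 hD] _] := sg.
have l0 : 0 <= l%:R :> R by [].
have F0 := normr_ge0 f0; have G0 := normr_ge0 g0.
split.
  exists (l%:R * (C * `|g0|) + l%:R * (`|f0| * D)) => [|h].
    by rewrite addr_ge0 ?mulr_ge0.
  rewrite (le_trans (ler_normD _ _))// mulrDl lerD// (le_trans (norm_mulmx _ _))//.
    by rewrite -mulrA ler_wpM2l// mulrAC ler_wpM2r.
  by rewrite -mulrA ler_wpM2l// -mulrA ler_wpM2l.
(* The factor of [e1] collects the four error terms of the Leibniz rule below; the cap at 1 bounds
   [g t z] and [f t z']. *)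
move=> e e0; pose N := l%:R * (`|f0| + `|g0| + 2 + C + D) + 1.
have N0 : 0 < N by rewrite ltr_wpDl// mulr_ge0// !addr_ge0.
pose e1 := Num.min 1 (e / N).
have e10 : 0 < e1 by rewrite lt_min ltr01 divr_gt0.
have e11 : e1 <= 1 by rewrite ge_min lexx.
have e1N : l%:R * (`|f0| + `|g0| + 2 + C + D) * e1 <= e.
  rewrite (@le_trans _ _ (N * e1))//; first by rewrite ler_wpM2r ?lerDl// ltW.
  by rewrite mulrC -ler_pdivlMr// ge_min lexx orbT.
have [d d0 h] := sdiff_near2 sf sg e10.
exists d => //; apply: filterS h => t ht z z' hz hz'.
have [[h1 h2] [h3 h4]] := ht z z' hz hz'.
have [[h1' _] _] := ht z' z hz' hz.
have gz : `|g t z| <= `|g0| + 1.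
  by rewrite -[g t z](subrK g0) (le_trans (ler_normD _ _))//; lra.
have fz : `|f t z'| <= `|f0| + 1.
  by rewrite -[f t z'](subrK f0) (le_trans (ler_normD _ _))//; lra.
have P a b c a' b' (X : 'M[R]_(a, b)) (Y : 'M[R]_(b, c)) :
    `|X| <= a' -> `|Y| <= b' -> `|X *m Y| <= b%:R * (a' * b').
  by move=> *; rewrite (le_trans (norm_mulmx _ _))// ler_wpM2l// ler_pM.
split.
  have -> : f t z *m g t z - f0 *m g0 = (f t z - f0) *m g t z + f0 *m (g t z - g0).
    by mxdistr; mxentry; ring.
  rewrite (le_trans (ler_normD _ _))//.
  have a1 := P _ _ _ _ _ _ _ h1 gz; have a2 := P _ _ _ _ _ _ _ (lexx `|f0|) h3.
  rewrite (le_trans (lerD a1 a2))// (le_trans _ e1N)//.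
  rewrite -mulrDr -mulrA ler_wpM2l// -subr_ge0.
  have -> : (`|f0| + `|g0| + 2 + C + D) * e1 - (e1 * (`|g0| + 1) + `|f0| * e1)
    = (1 + C + D) * e1 by ring.
  by rewrite mulr_ge0 ?addr_ge0// ltW.
(* Each of the four summands contains exactly one small factor. *)
have -> : f t z *m g t z - f t z' *m g t z' - (L (z - z') *m g0 + f0 *m M (z - z')) =
   ((f t z - f t z' - L (z - z')) *m g t z + L (z - z') *m (g t z - g0)) +
   (f t z' *m (g t z - g t z' - M (z - z')) + (f t z' - f0) *m M (z - z')).
  by mxdistr; mxentry; ring.
have a1 := P _ _ _ _ _ _ _ h2 gz; have a2 := P _ _ _ _ _ _ _ (hC (z - z')) h3.
have a3 := P _ _ _ _ _ _ _ fz h4; have a4 := P _ _ _ _ _ _ _ h1' (hD (z - z')).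
rewrite (le_trans (ler_normD _ _))//.
rewrite (le_trans (lerD (ler_normD _ _) (ler_normD _ _)))//.
rewrite (le_trans (lerD (lerD a1 a2) (lerD a3 a4)))//.
rewrite (le_trans _ (ler_wpM2r (normr_ge0 _) e1N))//.
by rewrite le_eqVlt; apply/orP; left; apply/eqP; ring.
Qed.

Lemma sdiff_scale k l (a : T -> R) a0 (f : T -> V -> 'M[R]_(k, l)) f0 L :
  (forall e, 0 < e -> \forall t \near F, `|a t - a0| <= e) ->
  sdiff f f0 L -> sdiff (fun t z => a t *: f t z) (a0 *: f0) (fun h => a0 *: L h).
Proof.
move=> ha sf.
have sa : sdiff (fun t _ => (a t)%:M : 'M[R]_k) a0%:M (fun=> 0).
  apply: sdiff_param => e /ha; apply: filterS => t; apply: le_trans.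
  by rewrite -raddfB /=; exact: norm_scalar_mx.
have := sdiffM sa sf; rewrite mul_scalar_mx.
have -> : (fun t z => (a t)%:M *m f t z) = (fun t z => a t *: f t z).
  by apply/funext => t; apply/funext => z; rewrite mul_scalar_mx.
have -> // : (fun h => 0 *m f0 + a0%:M *m L h) = (fun h => a0 *: L h).
by apply/funext => h; rewrite mul_scalar_mx mul0mx add0r.
Qed.

Lemma norm_col_mx k k' l (M : 'M[R]_(k, l)) (N : 'M[R]_(k', l)) e :
  0 <= e -> `|M| <= e -> `|N| <= e -> `|col_mx M N| <= e.
Proof.
move=> e0 hM hN; apply: norm_le_entry => // i j; rewrite mxE.
by case: (fintype.split i) => a; rewrite (le_trans (le_entry_norm _ _ _)).
Qed.

Lemma col_mxB k k' l (M M' : 'M[R]_(k, l)) (N N' : 'M[R]_(k', l)) :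
  col_mx M N - col_mx M' N' = col_mx (M - M') (N - N').
Proof. by rewrite opp_col_mx add_col_mx. Qed.

Lemma sdiff_col k k' l (f : T -> V -> 'M[R]_(k, l)) (g : T -> V -> 'M[R]_(k', l))
    f0 g0 L M : sdiff f f0 L -> sdiff g g0 M ->
  sdiff (fun t z => col_mx (f t z) (g t z)) (col_mx f0 g0) (fun h => col_mx (L h) (M h)).
Proof.
move=> sf sg; have [[C C0 hC] _] := sf; have [[D D0 hD] _] := sg.
split.
  exists (C + D) => [|h]; first exact: addr_ge0.
  have := mulr_ge0 D0 (normr_ge0 h); have := mulr_ge0 C0 (normr_ge0 h).
  have := hC h; have := hD h => *.
  by apply: norm_col_mx; rewrite mulrDl; lra.
move=> e e0; have [d d0 h] := sdiff_near2 sf sg e0.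
exists d => //; apply: filterS h => t ht z z' hz hz'.
have [[h1 h2] [h3 h4]] := ht z z' hz hz'; rewrite !col_mxB.
by split; apply: norm_col_mx => //; rewrite ?mulr_ge0// ltW.
Qed.

(* Contraction principle applied to z |-> z - L^-1 (f t z). *)
Theorem implicit_function (f : T -> V -> V) L :
  sdiff f 0 L -> linear L -> (forall h, L h = 0 -> h = 0) ->
  exists2 C, 0 < C & \forall t \near F, exists2 z, f t z = 0 & `|z - z0| <= C * `|f t z0|.
Proof.
move=> [_ sf] Llin Linj.
have [g [Lg gL gB [C C0 gC]]] := linear_inj_inv Llin Linj.
have C20 : 0 < 2 * C by rewrite mulr_gt0.
(* This tolerance makes the contraction factor 1/2; the next one makes the residual at [z0] so small
   that the radius [r] fits inside [d]. *)
have [d d0 hd] := sf _ (divr_gt0 ltr01 C20).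
have [d' d'0 hd'] := sf _ (divr_gt0 d0 C20).
exists (2 * C) => //; apply: filterS2 hd hd' => t ht ht'.
(* The centre moves by at most [r / 2] and distances to it are halved, so the ball of radius [r] is
   mapped into itself. *)
pose r := 2 * C * `|f t z0|.
have r0 : 0 <= r by rewrite mulr_ge0 ?(ltW C20).
have rd : r <= d.
  rewrite /r mulrC -ler_pdivlMr//.
  by have [||+ _] := ht' z0 z0; rewrite ?subrr ?normr0 ?subr0 ?(ltW d'0).
have g0 : g 0 = 0 by rewrite -[X in g X](subrr 0) gB subrr.
pose Phi z := z - g (f t z).
have ctr z z' : `|z - z0| <= r -> `|z' - z0| <= r -> `|Phi z - Phi z'| <= 2^-1 * `|z - z'|.
  move=> hz hz'; have [_ h] := ht z z' (le_trans hz rd) (le_trans hz' rd).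
  have -> : Phi z - Phi z' = - g (f t z - f t z' - L (z - z')).
    by rewrite !gB gL /Phi; mxentry; ring.
  rewrite normrN (le_trans (gC _))// (le_trans (ler_wpM2l (ltW C0) h))// mulrA.
  by rewrite ler_wpM2r// le_eqVlt; apply/orP; left; apply/eqP; field; rewrite gt_eqF.
pose U := closed_ball_ (fun x : V => `|x|) z0 r.
have z0U : U z0 by rewrite /U /closed_ball_ /= subrr normr0.
have UP z : U z <-> `|z - z0| <= r by rewrite /U /closed_ball_ /= distrC.
have PhiU : {homo Phi : x / U x >-> U x}.
  move=> z /UP hz; apply/UP.
  have -> : Phi z - z0 = (Phi z - Phi z0) + (Phi z0 - z0) by rewrite subrKA.
  rewrite (le_trans (ler_normD _ _))//.
  have h1 : `|Phi z - Phi z0| <= 2^-1 * r.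
    by rewrite (le_trans (ctr _ _ hz _)) ?subrr ?normr0// ler_wpM2l.
  have h2 : `|Phi z0 - z0| <= C * `|f t z0|.
    by rewrite /Phi addrAC subrr add0r normrN.
  by rewrite /r in h1 *; lra.
have [|||z /UP zU zfix] := @banach_fixed_point R V U (mkfun_fun PhiU).
- exists 2^-1%:nng; split=> /=; first by rewrite invf_lt1 ?ltr1n.
  by move=> [z z'] [/= /UP hz /UP hz']; exact: ctr.
- exact: closed_closed_ball_.
- by exists z0.
exists z => //.
have : g (f t z) = 0.
  have zf : z = Phi z := zfix.
  by rewrite -[LHS](subKr z) -/(Phi z) -zf subrr.
move=> /(congr1 L); rewrite Lg => ->.
by have := Llin (-1) 0 0; rewrite scaler0 addr0 scaleN1r addNr.
Qed.

End StrictDifferentiability.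

(** * Local bound for the H-infinity norm *)

Section HinfBound.
Variable R : realType.

Lemma cmx_ex p q (v : 'M[R[i]]_(p, q)) : exists x y, v = cmx x y.
Proof. by exists (map_mx (@complex.Re R) v), (map_mx (@complex.Im R) v); exact: cmx_split. Qed.

Lemma cvnorm_cmx k (x y : 'cV[R]_k) : cvnorm (cmx x y) = Num.sqrt (nsq x + nsq y).
Proof.
rewrite /cvnorm !nsqE -big_split /=; congr Num.sqrt.
by apply: eq_bigr => i _; rewrite !mxE.
Qed.

(** The supremum of the empty set is 0, whence the sign condition on [C]; the case arises for
    [sigma_max] in dimension 0, where there are no unit vectors. *)
Lemma sup_le_ge0 (S : set R) C : 0 <= C -> (forall x, S x -> x <= C) -> sup S <= C.
Proof.
move=> C0 h; have [->|/set0P S0] := eqVneq S set0; first by rewrite sup0.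
exact: ge_sup.
Qed.

(* AM-GM *)
Lemma bf_young p (P : 'M[R]_p) x y c : 0 < c ->
  bf P x y <= c / 4 * nsq x + nsq (P *m y) / c.
Proof.
move=> c0; have := nsq_ge0 ((c / 2) *: x - P *m y).
have xPy : bf P x y = bf 1%:M x (P *m y) by rewrite /bf mulmx1 mulmxA.
have s : bf 1%:M (P *m y) x = bf 1%:M x (P *m y) by rewrite -bf_tr trmx1.
rewrite -bf1 !(bfDl, bfDr, bfNl, bfNr, bfZl, bfZr) s !bf1 -xPy => h.
rewrite -(ler_pM2l c0).
have -> : c * (c / 4 * nsq x + nsq (P *m y) / c) = c ^+ 2 / 4 * nsq x + nsq (P *m y).
  by field; rewrite gt_eqF.
lra.
Qed.

Lemma resolvent_eq n (A : 'M[R]_n) w (x y : 'cV[R]_n) :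
  ((Complex 0 w)%:M - mxC A) *m cmx x y = cmx (- (w *: y) - A *m x) (w *: x - A *m y).
Proof.
rewrite mulmxBl mul_scalar_mx cmxZ mxC_mul_cmx.
by apply/matrixP => i j; rewrite !mxE; simpc; congr Complex; ring.
Qed.

(** Pairing the resolvent equation with [P] cancels the terms in [w] by symmetry, which makes the
    bound uniform in the frequency. Young's inequality absorbs half of the resulting coercive
    term. *)
Lemma resolvent_bound n (A P : 'M[R]_n) c w (x y p q : 'cV[R]_n) :
  P^T = P -> 0 < c -> (forall x, bf (lyap A^T P) x x <= - c * nsq x) ->
  p = - (w *: y) - A *m x -> q = w *: x - A *m y ->
  nsq x + nsq y <= 4 / c ^+ 2 * (nsq (P *m p) + nsq (P *m q)).
Proof.
move=> Ps c0 hP hp hq.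
have hx := hP x; have hy := hP y; rewrite !bf_lyap// !trmxK in hx hy.
have sy : bf P y x = bf P x y by rewrite -bf_tr Ps.
have sx z z' : bf P (A *m z) z' = bf P z' (A *m z) by rewrite -bf_tr Ps.
have e : bf P x p + bf P y q = - (bf P (A *m x) x + bf P (A *m y) y).
  by rewrite hp hq !(bfDr, bfNr, bfZr) sy !sx; ring.
have yx := bf_young P x p c0; have yy := bf_young P y q c0.
have h : c / 4 * (nsq x + nsq y) <= (nsq (P *m p) + nsq (P *m q)) / c.
  by rewrite mulrDl; lra.
rewrite -(ler_pM2l (divr_gt0 c0 (ltr0n R 4))) (le_trans h)// le_eqVlt.
by apply/orP; left; apply/eqP; field; rewrite gt_eqF.
Qed.

Lemma sigma_max_Tinf_le n m (A : 'M[R]_n) (B : 'M[R]_(n, m)) (Bw Qinf P : 'M[R]_n)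
    (Rinf : 'M[R]_m) K w c b : 
  P^T = P -> 0 < c -> (forall x, bf (lyap (AK A B K)^T P) x x <= - c * nsq x) ->
  0 <= b -> (forall x, nsq (col_mx (mx_sqrt Qinf) (mx_sqrt Rinf *m K) *m x) <= b * nsq x) ->
  sigma_max (Tinf A B Bw Qinf Rinf K w) <=
  Num.sqrt (b * (4 / c ^+ 2 * (n%:R * (n%:R * `|P *m Bw|) ^+ 2))).
Proof.
move=> Ps c0 hP b0 hb; apply: sup_le_ge0 => [|_ [v v1 <-]]; first exact: sqrtr_ge0.
have rb := resolvent_bound Ps c0 hP.
(* The resolvent bound with zero right side gives injectivity, so [invmx] is a genuine inverse
   here. *)
have Mu : (Complex 0 w)%:M - mxC (AK A B K) \in unitmx.
  apply: unitmx_ker => z; have [x [y ->]] := cmx_ex z.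
  rewrite resolvent_eq -cmx0 => /cmx_inj[hx hy].
  have := rb w _ _ _ _ (esym hx) (esym hy).
  rewrite mulmx0 {3 4}/nsq mulmx0 mxE addr0 mulr0.
  move=> h; have := nsq_ge0 x; have := nsq_ge0 y => h1 h2.
  have -> : x = 0 by apply: nsq_eq0; lra.
  by have -> : y = 0 by apply: nsq_eq0; lra.
move: v1 => /=; have [v1 [v2 ->]] := cmx_ex v; rewrite cvnorm_cmx /Tinf => hv.
rewrite -!mulmxA mxC_mul_cmx.
set u := invmx _ *m _.
have : ((Complex 0 w)%:M - mxC (AK A B K)) *m u = cmx (Bw *m v1) (Bw *m v2).
  by rewrite /u mulKVmx.
have [x [y ->]] := cmx_ex u; rewrite resolvent_eq => /cmx_inj[hx hy].
have {}rb := rb w _ _ _ _ (esym hx) (esym hy).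
rewrite mxC_mul_cmx cvnorm_cmx ler_wsqrtr//.
rewrite (le_trans (lerD (hb x) (hb y)))// -mulrDr ler_wpM2l// (le_trans rb)//.
have c2 : 0 <= 4 / c ^+ 2 by rewrite divr_ge0 ?sqr_ge0.
rewrite ler_wpM2l// !mulmxA (le_trans (lerD (nsq_mulmx _ _) (nsq_mulmx _ _)))//.
rewrite -mulrDr.
have -> : nsq v1 + nsq v2 = 1.
  rewrite -[LHS]sqr_sqrtr ?addr_ge0 ?nsq_ge0//.
  by rewrite hv expr1n.
by rewrite mulr1.
Qed.

Lemma hinf_norm_bounded n m (A : 'M[R]_n) (B : 'M[R]_(n, m)) (Bw Qinf : 'M[R]_n)
    (Rinf : 'M[R]_m) K0 : hurwitz (AK A B K0) ->
  exists2 C, 0 <= C & exists2 d, 0 < d & forall K, `|K - K0| <= d ->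
    hinf_norm A B Bw Qinf Rinf K <= C.
Proof.
move=> /hurwitz_tr/hurwitz_robust[P [c [d [Ppd c0 d0 hP]]]].
pose N := m%:R * `|B| + 1; have N0 : 0 < N by rewrite ltr_wpDl// mulr_ge0.
pose M := `|mx_sqrt Qinf| + m%:R * (`|mx_sqrt Rinf| * (`|K0| + 1)).
have M0 : 0 <= M by rewrite addr_ge0// !mulr_ge0// addr_ge0.
pose b := (n + m)%:R * (n%:R * M) ^+ 2; have b0 : 0 <= b by rewrite mulr_ge0 ?sqr_ge0.
exists (Num.sqrt (b * (4 / c ^+ 2 * (n%:R * (n%:R * `|P *m Bw|) ^+ 2)))).
  exact: sqrtr_ge0.
(* The 1 bounds the norm of [K], and [d / N] keeps [AK A B K] in the ball certified by [P]. *)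
exists (Num.min 1 (d / N)) => [|K]; first by rewrite lt_min ltr01 divr_gt0.
rewrite le_min => /andP[K1 KN].
apply: sup_le_ge0 => [|_ [w _ <-]]; first exact: sqrtr_ge0.
apply: sigma_max_Tinf_le => //; first by have [] := Ppd.
  apply: hP; rewrite -raddfB /= norm_tr /AK opprD addrACA subrr add0r -mulmxBr.
  rewrite (le_trans (norm_mulmx _ _))// (@le_trans _ _ (N * (d / N)))//.
    by rewrite mulrA ler_pM// ?mulr_ge0// lerDl.
  by rewrite mulrC divfK// gt_eqF.
move=> x; rewrite (le_trans (nsq_mulmx _ _))// ler_wpM2r ?nsq_ge0// ler_wpM2l//.
rewrite lerXn2r ?nnegrE ?mulr_ge0// ler_wpM2l//.
have hK : `|K| <= `|K0| + 1.
  by rewrite -[K](subrK K0) (le_trans (ler_normD _ _))// addrC lerD2l.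
have hMn : 0 <= m%:R * (`|mx_sqrt Rinf| * (`|K0| + 1)) by rewrite !mulr_ge0// addr_ge0.
apply: norm_col_mx => //; first by rewrite lerDl.
rewrite (le_trans (norm_mulmx _ _))// (@le_trans _ _ (m%:R * (`|mx_sqrt Rinf| * (`|K0| + 1))))//.
  by rewrite !ler_wpM2l.
by rewrite lerDr.
Qed.

End HinfBound.

(** * Stabilizing solutions near a given gain *)

Section OrderOfMagnitude.
Variables (R : realType) (p q : nat) (z0 : 'M[R]_(p, q)).

Definition bigOpow (e : nat) k l (f : 'M[R]_(p, q) -> 'M[R]_(k, l)) :=
  exists2 C, 0 <= C & \forall z \near z0, `|f z| <= C * `|z - z0| ^+ e.

Lemma near_norm_le e : 0 < e -> \forall z \near z0, `|z - z0| <= e.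
Proof. by move=> e0; apply/nbhs_normP; exists e => //= z; rewrite /= distrC => /ltW. Qed.

Lemma bigOpow_cst k l (M : 'M[R]_(k, l)) : bigOpow 0 (fun=> M).
Proof. by exists `|M| => //; apply: (@nearW _ (nbhs z0)) => z; rewrite expr0 mulr1. Qed.

Lemma bigOpow_sub : bigOpow 1 (fun z => z - z0).
Proof. by exists 1 => //; apply: (@nearW _ (nbhs z0)) => z; rewrite expr1 mul1r. Qed.

Lemma bigOpow_tr e k l (f : 'M[R]_(p, q) -> 'M[R]_(k, l)) :
  bigOpow e f -> bigOpow e (fun z => (f z)^T).
Proof. by move=> [C C0 h]; exists C => //; apply: filterS h => z; rewrite norm_tr. Qed.

Lemma bigOpowD e k l (f g : 'M[R]_(p, q) -> 'M[R]_(k, l)) :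
  bigOpow e f -> bigOpow e g -> bigOpow e (fun z => f z + g z).
Proof.
move=> [C C0 hf] [D D0 hg]; exists (C + D); first exact: addr_ge0.
apply: filterS2 hf hg => z fz gz.
by rewrite (le_trans (ler_normD _ _))// mulrDl lerD.
Qed.

Lemma bigOpowZ e k l a (f : 'M[R]_(p, q) -> 'M[R]_(k, l)) :
  bigOpow e f -> bigOpow e (fun z => a *: f z).
Proof.
move=> [C C0 hf]; exists (`|a| * C); first exact: mulr_ge0.
by apply: filterS hf => z fz; rewrite normrZ -mulrA ler_wpM2l.
Qed.

Lemma bigOpowM e e' k l r (f : 'M[R]_(p, q) -> 'M[R]_(k, l))
    (g : 'M[R]_(p, q) -> 'M[R]_(l, r)) :
  bigOpow e f -> bigOpow e' g -> bigOpow (e + e') (fun z => f z *m g z).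
Proof.
move=> [C C0 hf] [D D0 hg]; exists (l%:R * (C * D)); first by rewrite !mulr_ge0.
apply: filterS2 hf hg => z fz gz.
rewrite (le_trans (norm_mulmx _ _))// -mulrA ler_wpM2l// exprD mulrACA.
by rewrite ler_pM.
Qed.

Lemma bigOpow_le e e' k l (f : 'M[R]_(p, q) -> 'M[R]_(k, l)) : (e <= e')%N ->
  bigOpow e' f -> bigOpow e f.
Proof.
move=> ee [C C0 hf]; exists C => //.
apply: filterS2 hf (near_norm_le ltr01) => z fz z1; rewrite (le_trans fz)// ler_wpM2l//.
by rewrite ler_wiXn2l.
Qed.

Lemma norm_trace k (M : 'M[R]_k) : `|\tr M| <= k%:R * `|M|.
Proof.
rewrite (le_trans (ler_norm_sum _ _ _))//.
rewrite (@le_trans _ _ (\sum_(i < k) `|M|)) ?ler_sum// => [i _|].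
  exact: le_entry_norm.
by rewrite sumr_const card_ord mulr_natl.
Qed.

(** A quadratic increment is o(h), so the zero map is a differential, and differentials are
    unique. *)
Lemma stationary_of_quadratic (f : 'M[R]_(p, q) -> R) C :
  (\forall z \near z0, `|f z - f z0| <= C * `|z - z0| ^+ 2) ->
  differentiable f z0 /\ forall h, 'd f z0 h = 0.
Proof.
move=> hf.
pose df : {linear 'M[R]_(p, q) -> R} := \0.
have dfc : continuous df by exact: cst_continuous.
have E : f \o shift z0 = cst (f z0) + df +o_ 0 id.
  apply/eqaddoP => e e0.
  have C10 : 0 < `|C| + 1 by rewrite ltr_wpDl.
  have h1 : \forall h \near (0 : 'M[R]_(p, q)), `|h| <= e / (`|C| + 1).
    apply/nbhs_normP; exists (e / (`|C| + 1)); first by rewrite /= divr_gt0.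
    by move=> h /=; rewrite sub0r normrN => /ltW.
  have h2 : \forall h \near (0 : 'M[R]_(p, q)), `|f (h + z0) - f z0| <= C * `|h| ^+ 2.
    move: hf; rewrite (near_shift 0) subr0; apply: filterS => h /=.
    by rewrite addrK.
  apply: filterS2 h1 h2 => h h1 h2.
  have -> : (f \o shift z0 - (cst (f z0) + df)) h = f (h + z0) - f z0.
    by rewrite !fctE /= /df addr0.
  rewrite (le_trans h2)// expr2 mulrA ler_wpM2r//.
  rewrite (@le_trans _ _ ((`|C| + 1) * `|h|))//.
    by rewrite ler_wpM2r// ler_wpDr// ler_norm.
  by rewrite mulrC -ler_pdivlMr.
have d0 := diff_unique dfc E.
split; last by move=> h; rewrite d0.
by apply/diff_locallyP; rewrite d0.
Qed.

End OrderOfMagnitude.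

Lemma sdiff_eq (R : realType) (T : Type) (F : set_system T) p q (z0 : 'M[R]_(p, q)) k l
    (f : T -> 'M[R]_(p, q) -> 'M[R]_(k, l)) f0 f0' L L' :
  sdiff F z0 f f0 L -> f0 = f0' -> L =1 L' -> sdiff F z0 f f0' L'.
Proof. by move=> + <- /funext <-. Qed.

Section RiccatiMap.
Variables (R : realType) (n : nat).
Implicit Types M S X Y N : 'M[R]_n.

(** A difference of Riccati values is a Sylvester expression in [X - Y]. No symmetry of [X] or [Y]
    is assumed, so that [Y] may be the transpose of [X]. *)
Lemma riccati_map_sub a M S X Y N : S^T = S ->
  (M *m X + X *m M^T + a *: (X *m S *m X) + N) -
  (M *m Y + Y *m M^T + a *: (Y *m S *m Y) + N) =
  (M + a *: (X *m S)) *m (X - Y) + (X - Y) *m (M + a *: (Y^T *m S))^T.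
Proof. by move=> Ss; mxdistr; rewrite Ss; mxentry; ring. Qed.

Lemma riccati_map_diff a M S X h : S^T = S ->
  M *m h + h *m M^T + a *: (h *m S *m X + X *m S *m h) =
  (M + a *: (X *m S)) *m h + h *m (M + a *: (X^T *m S))^T.
Proof. by move=> Ss; mxdistr; rewrite Ss; mxentry; ring. Qed.

Lemma riccati_map_tr a M S X N : S^T = S -> N^T = N ->
  (M *m X + X *m M^T + a *: (X *m S *m X) + N)^T =
  M *m X^T + X^T *m M^T + a *: (X^T *m S *m X^T) + N.
Proof. by move=> Ss Ns; mxdistr; rewrite Ss Ns; mxentry; ring. Qed.

End RiccatiMap.

Section Stationarity.
Variables (R : realType) (n m : nat).
Variables (A : 'M[R]_n) (B : 'M[R]_(n, m)) (Bw Qinf : 'M[R]_n) (Rinf : 'M[R]_m) (beta : R).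
Hypotheses (Qp : psd Qinf) (Rp : psd Rinf).
Local Notation AK := (AK A B).
Local Notation SK := (SK Qinf Rinf).
Local Notation XK := (XK A B Bw Qinf Rinf beta).
Local Notation stab_sol := (stab_sol A B Bw Qinf Rinf beta).
Local Notation eps := (beta ^-2).
Local Notation Acl K X := (AK K + eps *: (X *m SK K)).
Let ric K X := AK K *m X + X *m (AK K)^T + eps *: (X *m SK K *m X) + Wmx Bw.

Lemma SK_psd K : psd (SK K).
Proof. by apply: psdD => //; have := psd_congr K^T Rp; rewrite trmxK. Qed.

Lemma riccati_sub K X Y :
  ric K X - ric K Y = Acl K X *m (X - Y) + (X - Y) *m ((AK K) + eps *: (Y^T *m SK K))^T.
Proof. exact: riccati_map_sub (SK_psd K).1. Qed.

Lemma stab_sol_uniq K X Y : stab_sol K X -> stab_sol K Y -> X = Y.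
Proof.
move=> [_ [hX hAX]] [[Ys _] [hY hAY]]; apply/eqP; rewrite -subr_eq0; apply/eqP.
apply: (sylvester_uniq hAX (hurwitz_tr hAY)).
have := riccati_sub K X Y; rewrite Ys => <-.
by rewrite /ric hX hY subrr.
Qed.

Lemma XK_eq K X : stab_sol K X -> XK K = X.
Proof. by move=> sX; apply: xget_unique => // Y sY; exact: stab_sol_uniq sY sX. Qed.

(** A root given by the implicit function theorem need not be symmetric a priori. Its transpose is
    another root, and the difference solves a Sylvester equation with Hurwitz coefficients;
    positivity then follows from the Lyapunov equation of [AK K]. *)
Lemma stab_sol_intro K X : hurwitz (AK K) -> hurwitz (Acl K X) -> ric K X = 0 ->
  stab_sol K X.
Proof.
move=> hK hAX hX.
have Xs : X^T = X.
  apply/eqP; rewrite eq_sym -subr_eq0; apply/eqP.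
  apply: (sylvester_uniq hAX (hurwitz_tr hAX)).
  have := riccati_sub K X X^T; rewrite trmxK => <-; rewrite hX.
  have := riccati_map_tr eps (AK K) X (SK_psd K).1 (psd_gram Bw).1.
  by rewrite -/(Wmx Bw) -/(ric K X) -/(ric K X^T) hX trmx0 => <-; rewrite subrr.
split; last by split.
have Mp : psd (eps *: (X *m SK K *m X) + Wmx Bw).
  apply: psdD; last exact: psd_gram.
  apply: psdZ; first by rewrite invr_ge0 exprn_even_ge0.
  by have := psd_congr X (SK_psd K); rewrite Xs.
apply: (hurwitz_lyap_psd hK Mp).
by apply/eqP; rewrite -addr_eq0 addrA; apply/eqP.
Qed.

Section Near.
Variables (K0 : 'M[R]_(m, n)) (X0 : 'M[R]_n).
Hypotheses (hK0 : hurwitz (AK K0)) (hX0 : ric K0 X0 = 0) (hAcl : hurwitz (Acl K0 X0)).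

Let sd := @sdiff R 'M[R]_(m, n) (nbhs K0) n n X0.

Let sdK : sd (fun K _ => K) K0 (fun=> 0).
Proof.
by apply: sdiff_param => e; exact: near_norm_le.
Qed.

Let sdX : sd (fun _ X => X) X0 id.
Proof. exact: sdiff_lin. Qed.

Let sdc k l (M : 'M[R]_(k, l)) := sdiff_cst (nbhs_filter K0) X0 M.

Let sdA : sd (fun K _ => AK K) (AK K0) (fun=> 0).
Proof.
apply: sdiff_eq (sdiffD _ (sdc A) (sdiffM _ (sdc B) sdK)) _ _ => // h.
by rewrite mulmx0 mul0mx !addr0.
Qed.

Let sdS : sd (fun K _ => SK K) (SK K0) (fun=> 0).
Proof.
apply: sdiff_eq
  (sdiffD _ (sdc Qinf) (sdiffM _ (sdiffM _ (sdiff_tr _ sdK) (sdc Rinf)) sdK)) _ _ => // h.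
by rewrite !(trmx0, mulmx0, mul0mx, addr0).
Qed.

Let epsc e : 0 < e -> \forall K \near K0, `|eps - eps| <= e.
Proof. by move=> e0; apply: (@nearW _ (nbhs K0)) => K; rewrite subrr normr0 ltW. Qed.

Let sdAcl : sd (fun K X => Acl K X) (Acl K0 X0) (fun h => eps *: (h *m SK K0)).
Proof.
apply: sdiff_eq (sdiffD _ sdA (sdiff_scale _ epsc (sdiffM _ sdX sdS))) _ _ => // h.
by rewrite mulmx0 addr0 add0r.
Qed.

Let sdric : sd (fun K X => ric K X) 0
  (fun h => Acl K0 X0 *m h + h *m (AK K0 + eps *: (X0^T *m SK K0))^T).
Proof.
apply: sdiff_eq (sdiffD _ (sdiffD _ (sdiffD _ (sdiffM _ sdA sdX)
  (sdiffM _ sdX (sdiff_tr _ sdA))) (sdiff_scale _ epsc (sdiffM _ (sdiffM _ sdX sdS) sdX)))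
  (sdc (Wmx Bw))) hX0 _ => h.
rewrite !(trmx0, mulmx0, mul0mx, addr0, add0r).
exact: riccati_map_diff (SK_psd K0).1.
Qed.

Lemma linearized_riccati_inj h :
  Acl K0 X0 *m h + h *m (AK K0 + eps *: (X0^T *m SK K0))^T = 0 -> h = 0.
Proof.
have [[Xs _] _] := stab_sol_intro hK0 hAcl hX0; rewrite Xs.
by move/(sylvester_uniq hAcl (hurwitz_tr hAcl)).
Qed.

(** The implicit function theorem, with [K] as parameter, gives a root near [X0]. Openness makes it
    stabilizing, and uniqueness identifies it with [XK K]. *)
Lemma XK_near : exists2 C, 0 < C & \forall K \near K0,
  stab_sol K (XK K) /\ `|XK K - X0| <= C * `|ric K X0|.
Proof.
have [C C0 hC] := implicit_function _ sdric (linear_sylvester _ _) linearized_riccati_inj.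
exists C => //.
have [dA dA0 hdA] := hurwitz_open hAcl.
have [dK dK0 hdK] := hurwitz_open hK0.
have [_ sA1] := sdAcl; have [_ sA2] := sdA; have [_ sr] := sdric.
have [d1 d10 h1] := sA1 _ dA0.
have [d2 d20 h2] := sA2 _ dK0.
(* A residual below [d1 / C] puts the root within [d1] of [X0], where the closed loop is still
   Hurwitz. *)
have [d3 d30 h3] := sr _ (divr_gt0 d10 C0).
apply: filterS2 hC (filterI h1 (filterI h2 h3)) => K [X rX dX] [{}h1 [{}h2 {}h3]].
have X00 d : 0 < d -> `|X0 - X0| <= d by move=> d0; rewrite subrr normr0 ltW.
have n1 : `|ric K X0| <= d1 / C.
  by have [+ _] := h3 X0 X0 (X00 _ d30) (X00 _ d30); rewrite subr0.
have Xd : `|X - X0| <= d1 by rewrite (le_trans dX)// mulrC -ler_pdivlMr.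
have hA : hurwitz (Acl K X) by apply: hdA; have [] := h1 X X Xd Xd.
have hK : hurwitz (AK K).
  by apply: hdK; have [] := h2 X0 X0 (X00 _ d20) (X00 _ d20).
have sX := stab_sol_intro hK hA rX.
by rewrite (XK_eq sX).
Qed.

End Near.

End Stationarity.

(** * Second-order expansion of the cost *)

Section CostExpansion.
Variables (R : realType) (n m : nat).
Variables (A : 'M[R]_n) (B : 'M[R]_(n, m)) (W Q2 : 'M[R]_n) (R2 : 'M[R]_m)
  (Qinf : 'M[R]_n) (Rinf : 'M[R]_m) (eps : R).
Hypotheses (R2s : R2^T = R2) (Qs : Qinf^T = Qinf) (Rs : Rinf^T = Rinf).
Variables (K D : 'M[R]_(m, n)) (X Y H : 'M[R]_n).
Hypotheses (Xs : X^T = X) (Ys : Y^T = Y).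

Let S := SK Qinf Rinf K.
Let dS := D^T *m Rinf *m K + K^T *m Rinf *m D.
Let M := AK A B K + eps *: (X *m S).
(** All terms of order at least two jointly in [D] and [H] in the Riccati increment. *)
Let remainder := B *m D *m H + H *m (B *m D)^T
  + eps *: (H *m S *m H + X *m (D^T *m Rinf *m D) *m X + H *m (dS + D^T *m Rinf *m D) *m X
    + X *m (dS + D^T *m Rinf *m D) *m H + H *m (dS + D^T *m Rinf *m D) *m H).
Let ric K X := AK A B K *m X + X *m (AK A B K)^T + eps *: (X *m SK Qinf Rinf K *m X) + W.

Lemma riccati_map_expand a (N E T T1 T2 : 'M[R]_n) : T^T = T ->
  ((N + E) *m (X + H) + (X + H) *m (N + E)^T + a *: ((X + H) *m (T + T1 + T2) *m (X + H)) + W)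
  - (N *m X + X *m N^T + a *: (X *m T *m X) + W)
  = (N + a *: (X *m T)) *m H + H *m (N + a *: (X *m T))^T
    + (E *m X + X *m E^T + a *: (X *m T1 *m X)) +
    (E *m H + H *m E^T + a *: (H *m T *m H + X *m T2 *m X + H *m (T1 + T2) *m X
       + X *m (T1 + T2) *m H + H *m (T1 + T2) *m H)).
Proof. by move=> Ts; mxdistr; rewrite Ts Xs; mxentry; ring. Qed.

Lemma riccati_map_perturb a (N E T T1 : 'M[R]_n) :
  (N + E) *m X + X *m (N + E)^T + a *: (X *m (T + T1) *m X) + W =
  (N *m X + X *m N^T + a *: (X *m T *m X) + W)
  + (E *m X + X *m E^T + a *: (X *m T1 *m X)).
Proof. by mxdistr; mxentry; ring. Qed.

Lemma SK_expand : SK Qinf Rinf (K + D) = S + (dS + D^T *m Rinf *m D).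
Proof. by rewrite /S /dS /SK; mxdistr; mxentry; ring. Qed.

Lemma AK_expand : AK A B (K + D) = AK A B K + B *m D.
Proof. by rewrite /AK mulmxDr addrA. Qed.

Lemma riccati_perturb : ric (K + D) X = ric K X + (B *m D *m X + X *m (B *m D)^T
  + eps *: (X *m (dS + D^T *m Rinf *m D) *m X)).
Proof. by rewrite -riccati_map_perturb /ric AK_expand SK_expand. Qed.

Lemma riccati_expand : ric (K + D) (X + H) - ric K X =
  M *m H + H *m M^T + (B *m D *m X + X *m (B *m D)^T + eps *: (X *m dS *m X)) + remainder.
Proof.
have Ss : S^T = S.
  by rewrite /S /SK; mxdistr; rewrite Qs Rs.
by rewrite -(riccati_map_expand _ _ _ _ _ Ss) /ric AK_expand SK_expand addrA.
Qed.

Lemma trace_flip p (N N' : 'M[R]_p) : N^T = N' -> \tr N = \tr N'.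
Proof. by move=> <-; rewrite mxtrace_tr. Qed.

(** [Y] is the adjoint variable: its Lyapunov equation turns the trace of [C *m H] into a pairing
    with the linearized Riccati equation. The first-order terms then add up to twice the trace of
    [D^T] times the stationarity expression times [X]. *)
Lemma first_order_cancel (N C Rm : 'M[R]_n) :
  lyap N^T Y = - C ->
  N *m H + H *m N^T = - (B *m D *m X + X *m (B *m D)^T
    + eps *: (X *m (D^T *m Rinf *m K + K^T *m Rinf *m D) *m X)) - Rm ->
  R2 *m K + B^T *m Y + eps *: (Rinf *m K *m X *m Y) = 0 ->
  \tr (C *m H) + \tr ((D^T *m R2 *m K + K^T *m R2 *m D) *m X) = \tr (Y *m Rm).
Proof.
move=> hY e1 hs.
have t1 : \tr (C *m H) = - \tr (Y *m (N *m H + H *m N^T)).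
  rewrite -[C]opprK -hY mulNmx raddfN /=; congr (- _).
  rewrite /lyap trmxK mulmxDl mulmxDr !raddfD /= [LHS]addrC; congr (_ + _).
    by rewrite mulmxA.
  by rewrite -mulmxA mxtrace_mulC mulmxA.
have t2 : \tr (D^T *m (R2 *m K + B^T *m Y + eps *: (Rinf *m K *m X *m Y)) *m X) = 0.
  by rewrite hs mulmx0 mul0mx mxtrace0.
(* Cyclicity and transposition bring all first-order traces to a form beginning with [D^T]. *)
have f1 : \tr (Y *m (B *m D *m X)) = \tr (D^T *m B^T *m Y *m X).
  rewrite (@trace_flip _ _ (X *m (D^T *m B^T *m Y))) 1?mxtrace_mulC//.
  by rewrite !trmx_mul Xs Ys !mulmxA.
have f2 : \tr (Y *m (X *m (B *m D)^T)) = \tr (D^T *m B^T *m Y *m X).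
  by rewrite mulmxA mxtrace_mulC trmx_mul !mulmxA.
have f3 : \tr (Y *m (X *m (D^T *m Rinf *m K) *m X)) =
    \tr (D^T *m Rinf *m K *m X *m Y *m X).
  by rewrite -!mulmxA [Y *m (X *m _)]mulmxA mxtrace_mulC !mulmxA.
have f4 : \tr (Y *m (X *m (K^T *m Rinf *m D) *m X)) =
    \tr (D^T *m Rinf *m K *m X *m Y *m X).
  rewrite (@trace_flip _ _ (X *m (D^T *m Rinf *m K *m X *m Y))) 1?mxtrace_mulC//.
  by rewrite !trmx_mul trmxK Xs Ys Rs !mulmxA.
have f5 : \tr (K^T *m R2 *m D *m X) = \tr (D^T *m R2 *m K *m X).
  rewrite (@trace_flip _ _ (X *m (D^T *m R2 *m K))) 1?mxtrace_mulC//.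
  by rewrite !trmx_mul trmxK Xs R2s !mulmxA.
have t3 : \tr (Y *m (N *m H + H *m N^T)) = - (2 * \tr (D^T *m B^T *m Y *m X)
    + 2 * eps * \tr (D^T *m Rinf *m K *m X *m Y *m X)) - \tr (Y *m Rm).
  rewrite e1 mulmxBr mulmxN raddfB /= raddfN /= !mulmxDr !raddfD /= f1 f2.
  rewrite -scalemxAr mxtraceZ mulmxDl mulmxDr raddfD /= f3 f4.
  by ring.
move: t2; rewrite !(mulmxDr, mulmxDl) -scalemxAr -scalemxAl !raddfD /= mxtraceZ !mulmxA => t2.
rewrite t1 t3 f5; lra.
Qed.

Lemma cost_expand :
  ric K X = 0 -> ric (K + D) (X + H) = 0 ->
  lyap M^T Y = - (Q2 + K^T *m R2 *m K) ->
  R2 *m K + B^T *m Y + eps *: (Rinf *m K *m X *m Y) = 0 ->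
  \tr ((Q2 + (K + D)^T *m R2 *m (K + D)) *m (X + H)) - \tr ((Q2 + K^T *m R2 *m K) *m X) =
  \tr (Y *m remainder + D^T *m R2 *m D *m X +
    (D^T *m R2 *m K + K^T *m R2 *m D + D^T *m R2 *m D) *m H).
Proof.
move=> r0 r1 hY hs.
have e1 : M *m H + H *m M^T =
    - (B *m D *m X + X *m (B *m D)^T + eps *: (X *m dS *m X)) - remainder.
  have := riccati_expand; rewrite r0 r1 subrr => /esym/eqP.
  by rewrite -addrA addr_eq0 opprD => /eqP.
have t := first_order_cancel hY e1 hs.
have e2 : Q2 + (K + D)^T *m R2 *m (K + D) = (Q2 + K^T *m R2 *m K) +
   ((D^T *m R2 *m K + K^T *m R2 *m D) + D^T *m R2 *m D).
  by mxdistr; mxentry; ring.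
rewrite e2 mxtraceD mxtraceD -t.
move: (Q2 + _) (D^T *m R2 *m K + _) (D^T *m R2 *m D) => C0 C1 C2.
by rewrite !(mulmxDl, mulmxDr, mxtraceD); ring.
Qed.

End CostExpansion.

(** * From the coupled system to a zero gradient *)

Section Stationary.
Variables (R : realType) (n m : nat).
Variables (A : 'M[R]_n) (B : 'M[R]_(n, m)) (Bw Q2 : 'M[R]_n) (R2 : 'M[R]_m)
  (Qinf : 'M[R]_n) (Rinf : 'M[R]_m) (beta : R).
Hypotheses (R2s : R2^T = R2) (Qp : psd Qinf) (Rp : psd Rinf).
Local Notation eps := (beta ^-2).

Theorem coupled_stationary K X Y :
  hurwitz (AK A B K) -> riccati A B Bw Qinf Rinf beta K X ->
  hurwitz (AK A B K + eps *: (X *m SK Qinf Rinf K)) -> Y^T = Y ->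
  lyap (AK A B K + eps *: (X *m SK Qinf Rinf K))^T Y = - (Q2 + K^T *m R2 *m K) ->
  R2 *m K + B^T *m Y + eps *: (Rinf *m K *m X *m Y) = 0 ->
  stationary A B Bw Q2 R2 Qinf Rinf beta K.
Proof.
move=> hK hX hA Ys hY hs.
have sX := stab_sol_intro Qp Rp hK hA hX; have Xs : X^T = X by have [[]] := sX.
have XE := XK_eq Qp Rp sX.
have [C C0 near_sol] := XK_near Qp Rp hK hX hA.
pose H K' := XK A B Bw Qinf Rinf beta K' - X.
have oD := bigOpow_sub K.
have oc k l (N : 'M[R]_(k, l)) := bigOpow_cst K N.
pose dS' K' := (K' - K)^T *m Rinf *m K + K^T *m Rinf *m (K' - K).
pose dS2 K' := (K' - K)^T *m Rinf *m (K' - K).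
have oS1 : bigOpow K 1 dS'.
  apply: bigOpowD; last exact: bigOpowM (bigOpowM (oc _ _ _) (oc _ _ _)) oD.
  exact: bigOpowM (bigOpowM (bigOpow_tr oD) (oc _ _ _)) (oc _ _ _).
have oS2 : bigOpow K 2 dS2.
  exact: bigOpowM (bigOpowM (bigOpow_tr oD) (oc _ _ _)) oD.
have oS : bigOpow K 1 (fun K' => dS' K' + dS2 K').
  by apply: bigOpowD => //; apply: bigOpow_le oS2.
have oBD : bigOpow K 1 (fun K' => B *m (K' - K)) by exact: bigOpowM (oc _ _ _) oD.
(* As [X] solves the equation at [K], its residual at [K'] consists of increments in [K' - K]
   only. *)
have oric : bigOpow K 1 (fun K' => AK A B K' *m X + X *m (AK A B K')^T +
    eps *: (X *m SK Qinf Rinf K' *m X) + Wmx Bw).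
  have -> : (fun K' => AK A B K' *m X + X *m (AK A B K')^T +
      eps *: (X *m SK Qinf Rinf K' *m X) + Wmx Bw) =
    (fun K' => B *m (K' - K) *m X + X *m (B *m (K' - K))^T +
      eps *: (X *m (dS' K' + dS2 K') *m X)).
    apply/funext => K'.
    have := riccati_perturb A B (Wmx Bw) Qinf Rinf eps K (K' - K) X.
    by rewrite subrKC => ->; rewrite hX add0r.
  apply: bigOpowD; last first.
    exact: bigOpowZ (bigOpowM (bigOpowM (oc _ _ X) oS) (oc _ _ X)).
  apply: bigOpowD; first exact: bigOpowM oBD (oc _ _ _).
  exact: bigOpowM (oc _ _ _) (bigOpow_tr oBD).
have oH : bigOpow K 1 H.
  have [c c0 hc] := oric; exists (C * c); first by rewrite mulr_ge0// ltW.
  apply: filterS2 near_sol hc => K' [_ h1] h2.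
  by rewrite (le_trans h1)// -mulrA ler_wpM2l// ltW.
pose rem K' := B *m (K' - K) *m H K' + H K' *m (B *m (K' - K))^T
  + eps *: (H K' *m SK Qinf Rinf K *m H K' + X *m dS2 K' *m X + H K' *m (dS' K' + dS2 K') *m X
    + X *m (dS' K' + dS2 K') *m H K' + H K' *m (dS' K' + dS2 K') *m H K').
have orem : bigOpow K 2 rem.
  apply: bigOpowD.
    apply: bigOpowD; first exact: bigOpowM oBD oH.
    exact: bigOpowM oH (bigOpow_tr oBD).
  apply: bigOpowZ; apply: bigOpowD; last first.
    (* This term is of order three and is weakened to order two. *)
    by apply: (@bigOpow_le _ _ _ _ 2 3) => //; exact: bigOpowM (bigOpowM oH oS) oH.
  apply: bigOpowD; last exact: bigOpowM (bigOpowM (oc _ _ _) oS) oH.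
  apply: bigOpowD; last exact: bigOpowM (bigOpowM oH oS) (oc _ _ _).
  apply: bigOpowD; last exact: bigOpowM (bigOpowM (oc _ _ _) oS2) (oc _ _ _).
  exact: bigOpowM (bigOpowM oH (oc _ _ _)) oH.
have oR2 : bigOpow K 2 (fun K' => (K' - K)^T *m R2 *m (K' - K)).
  exact: bigOpowM (bigOpowM (bigOpow_tr oD) (oc _ _ _)) oD.
have otot : bigOpow K 2 (fun K' => Y *m rem K' + (K' - K)^T *m R2 *m (K' - K) *m X +
    ((K' - K)^T *m R2 *m K + K^T *m R2 *m (K' - K) + (K' - K)^T *m R2 *m (K' - K)) *m H K').
  apply: bigOpowD.
    apply: bigOpowD; first exact: bigOpowM (oc _ _ Y) orem.
    exact: bigOpowM oR2 (oc _ _ _).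
  apply: (@bigOpowM _ _ _ _ 1 1) => //; apply: bigOpowD; last exact: bigOpow_le oR2.
  apply: bigOpowD; last exact: bigOpowM (bigOpowM (oc _ _ _) (oc _ _ _)) oD.
  exact: bigOpowM (bigOpowM (bigOpow_tr oD) (oc _ _ _)) (oc _ _ _).
have [c c0 hc] := otot.
apply: (@stationary_of_quadratic _ _ _ _ _ (n%:R * c)).
apply: filterS2 near_sol hc => K' [sK' _] hK'.
rewrite /Jmix XE.
have := @cost_expand _ _ _ A B (Wmx Bw) Q2 R2 Qinf Rinf eps R2s Qp.1 Rp.1 K (K' - K) X Y
  (H K') Xs Ys hX.
rewrite /H [K + _]addrC [X + _]addrC !subrK => ->//; last by have [_ []] := sK'.
by rewrite (le_trans (norm_trace _))// -mulrA ler_wpM2l.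
Qed.

End Stationary.

(** * Solving the coupled system for small eps *)

Section CoupledSystem.
Variables (R : realType) (n m : nat).
Variables (A : 'M[R]_n) (B : 'M[R]_(n, m)) (Bw Q2 : 'M[R]_n) (R2 : 'M[R]_m)
  (Qinf : 'M[R]_n) (Rinf : 'M[R]_m).
Variables (K0 : 'M[R]_(m, n)) (X0 Y0 : 'M[R]_n).
Hypotheses (R2s : R2^T = R2) (R2u : R2 \in unitmx) (Y0s : Y0^T = Y0).
Hypotheses (hK0 : hurwitz (AK A B K0)) (stat0 : B^T *m Y0 = - (R2 *m K0)).
Hypothesis X0E : lyap (AK A B K0) X0 = - Wmx Bw.
Hypothesis Y0E : lyap (AK A B K0)^T Y0 = - (Q2 + K0^T *m R2 *m K0).

(** The unknowns [K], [X], [Y] are stacked, and so are the three equations, since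
    [implicit_function] concerns maps of a matrix space into itself. *)
Let V := 'M[R]_(m + (n + n), n).
Let kk (z : V) : 'M[R]_(m, n) := usubmx z.
Let xx (z : V) : 'M[R]_n := usubmx (dsubmx z).
Let yy (z : V) : 'M[R]_n := dsubmx (dsubmx z).
Let z0 : V := col_mx K0 (col_mx X0 Y0).

Let kk0 : kk z0 = K0. Proof. by rewrite /kk col_mxKu. Qed.
Let xx0 : xx z0 = X0. Proof. by rewrite /xx col_mxKd col_mxKu. Qed.
Let yy0 : yy z0 = Y0. Proof. by rewrite /yy !col_mxKd. Qed.

Let kkP a (u v : V) : kk (a *: u + v) = a *: kk u + kk v.
Proof. by apply/matrixP => i j; rewrite !mxE. Qed.
Let xxP a (u v : V) : xx (a *: u + v) = a *: xx u + xx v.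
Proof. by apply/matrixP => i j; rewrite !mxE. Qed.
Let yyP a (u v : V) : yy (a *: u + v) = a *: yy u + yy v.
Proof. by apply/matrixP => i j; rewrite !mxE. Qed.

Let Acl (e : R) z := AK A B (kk z) + e *: (xx z *m SK Qinf Rinf (kk z)).
Let eqK (e : R) z := R2 *m kk z + B^T *m yy z + e *: (Rinf *m kk z *m xx z *m yy z).
Let eqX (e : R) z := AK A B (kk z) *m xx z + xx z *m (AK A B (kk z))^T
  + e *: (xx z *m SK Qinf Rinf (kk z) *m xx z) + Wmx Bw.
Let eqY (e : R) z := lyap (Acl e z)^T (yy z) + (Q2 + (kk z)^T *m R2 *m kk z).

Let sd := @sdiff R R (nbhs (0 : R)) (m + (n + n)) n z0.

Let sdk : sd (fun _ z => kk z) K0 kk.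
Proof.
rewrite -kk0; apply: sdiff_lin => [z z'|h]; first by rewrite /kk linearB.
by apply: norm_le_entry => // i j; rewrite mxE le_entry_norm.
Qed.
Let sdx : sd (fun _ z => xx z) X0 xx.
Proof.
rewrite -xx0; apply: sdiff_lin => [z z'|h]; first by rewrite /xx !linearB.
by apply: norm_le_entry => // i j; rewrite !mxE le_entry_norm.
Qed.
Let sdy : sd (fun _ z => yy z) Y0 yy.
Proof.
rewrite -yy0; apply: sdiff_lin => [z z'|h]; first by rewrite /yy !linearB.
by apply: norm_le_entry => // i j; rewrite !mxE le_entry_norm.
Qed.

Let sdc k l (M : 'M[R]_(k, l)) := sdiff_cst (nbhs_filter (0 : R)) z0 M.

Let e0 r : 0 < r -> \forall e \near (0 : R), `|e - 0| <= r.
Proof.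
by move=> r0; apply/nbhs_normP; exists r => //= e; rewrite /= sub0r normrN subr0 => /ltW.
Qed.

Let sdA : sd (fun _ z => AK A B (kk z)) (AK A B K0) (fun h => B *m kk h).
Proof.
apply: sdiff_eq (sdiffD _ (sdc A) (sdiffM _ (sdc B) sdk)) _ _ => // h.
by rewrite mul0mx !add0r.
Qed.

(** One rule serves both for [SK] and for the cost weight. *)
Let sdKRK k (N : 'M[R]_m) (M : 'M[R]_n) : k = N ->
  sd (fun _ z => M + (kk z)^T *m k *m kk z) (M + K0^T *m N *m K0)
    (fun h => (kk h)^T *m N *m K0 + K0^T *m N *m kk h).
Proof.
move=> ->; apply: sdiff_eq
  (sdiffD _ (sdc M) (sdiffM _ (sdiffM _ (sdiff_tr _ sdk) (sdc N)) sdk)) _ _ => // h.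
by rewrite mulmx0 addr0 add0r.
Qed.

Let sdAcl : sd Acl (AK A B K0) (fun h => B *m kk h).
Proof.
apply: sdiff_eq (sdiffD _ sdA (sdiff_scale _ e0 (sdiffM _ sdx (sdKRK Qinf (erefl Rinf))))) _ _.
  by rewrite scale0r addr0.
by move=> h; rewrite scale0r addr0.
Qed.

Let sdeqK : sd eqK 0 (fun h => R2 *m kk h + B^T *m yy h).
Proof.
apply: sdiff_eq (sdiffD _ (sdiffD _ (sdiffM _ (sdc R2) sdk) (sdiffM _ (sdc B^T) sdy))
  (sdiff_scale _ e0 (sdiffM _ (sdiffM _ (sdiffM _ (sdc Rinf) sdk) sdx) sdy))) _ _.
  by rewrite scale0r addr0 stat0 subrr.
by move=> h; rewrite scale0r addr0 !mul0mx !add0r.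
Qed.

Let sdeqX : sd eqX 0
  (fun h => lyap (AK A B K0) (xx h) + (B *m kk h *m X0 + X0 *m (B *m kk h)^T)).
Proof.
apply: sdiff_eq (sdiffD _ (sdiffD _ (sdiffD _ (sdiffM _ sdA sdx)
  (sdiffM _ sdx (sdiff_tr _ sdA)))
  (sdiff_scale _ e0 (sdiffM _ (sdiffM _ sdx (sdKRK Qinf (erefl Rinf))) sdx)))
  (sdc (Wmx Bw))) _ _.
  by rewrite scale0r addr0 -/(lyap _ _) X0E addNr.
by move=> h; rewrite scale0r !addr0 /lyap; mxentry; ring.
Qed.

Let sdeqY : sd eqY 0 (fun h => lyap (AK A B K0)^T (yy h) +
  ((B *m kk h)^T *m Y0 + Y0 *m (B *m kk h)
    + ((kk h)^T *m R2 *m K0 + K0^T *m R2 *m kk h))).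
Proof.
apply: sdiff_eq (sdiffD _ (sdiffD _ (sdiffM _ (sdiff_tr _ sdAcl) sdy)
  (sdiffM _ sdy (sdiff_tr _ (sdiff_tr _ sdAcl)))) (sdKRK Q2 (erefl R2))) _ _.
  by rewrite -/(lyap _ _) Y0E addNr.
by move=> h; rewrite /lyap !trmxK; mxentry; ring.
Qed.

Let L (h : V) : V := col_mx (R2 *m kk h + B^T *m yy h)
  (col_mx (lyap (AK A B K0) (xx h) + (B *m kk h *m X0 + X0 *m (B *m kk h)^T))
    (lyap (AK A B K0)^T (yy h) +
  ((B *m kk h)^T *m Y0 + Y0 *m (B *m kk h)
    + ((kk h)^T *m R2 *m K0 + K0^T *m R2 *m kk h)))).

Let f e z : V := col_mx (eqK e z) (col_mx (eqX e z) (eqY e z)).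

Let sdf : sd f 0 L.
Proof.
by apply: sdiff_eq (sdiff_col _ sdeqK (sdiff_col _ sdeqX sdeqY)) _ _; rewrite ?col_mx0.
Qed.

Let linear_L : linear L.
Proof.
move=> a u v; rewrite /L kkP xxP yyP !scale_col_mx !add_col_mx /lyap.
move: (kk u) (kk v) (xx u) (xx v) (yy u) (yy v) (AK A B K0) => k k' x x' y y' M.
by congr col_mx; [|congr col_mx]; mxdistr; mxentry; ring.
Qed.

(* The linearization at eps = 0 is triangular: by stationarity of K0 the terms in k cancel
   from the third block, which determines y; then k, then x. *)
Let L_inj h : L h = 0 -> h = 0.
Proof.
rewrite /L -[X in _ = X]vsubmxK !linear0 => /eq_col_mx[hk].
rewrite -[X in _ = X]vsubmxK !linear0 => /eq_col_mx[hx hy].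
have stat0' : Y0 *m B = - (K0^T *m R2).
  by rewrite -[LHS]trmxK trmx_mul Y0s stat0 linearN /= trmx_mul R2s.
have y0 : yy h = 0.
  have hA := hurwitz_tr hK0; apply: (sylvester_uniq hA (hurwitz_tr hA)).
  move: hy; rewrite trmx_mul -[_ *m B^T *m Y0]mulmxA stat0 mulmxA stat0'.
  by rewrite mulmxN mulNmx !mulmxA -opprD addNr addr0.
have k0 : kk h = 0.
  by move: hk; rewrite y0 mulmx0 addr0 => /(congr1 (mulmx (invmx R2))); rewrite mulKmx// mulmx0.
have x0 : xx h = 0.
  apply: (sylvester_uniq hK0 (hurwitz_tr hK0)).
  by move: hx; rewrite k0 mulmx0 trmx0 mulmx0 mul0mx !addr0.
rewrite -[h]vsubmxK -[dsubmx h]vsubmxK.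
by rewrite -/(kk h) -/(xx h) -/(yy h) k0 x0 y0 !col_mx0.
Qed.

(** The three distances are those needed afterwards: the first for the local bound on the H-infinity
    norm, the other two for openness of the Hurwitz property. *)
Lemma coupled_near r : 0 < r -> \forall e \near (0 : R), exists K X Y,
  [/\ `|K - K0| <= r, `|AK A B K - AK A B K0| <= r,
      `|AK A B K + e *: (X *m SK Qinf Rinf K) - AK A B K0| <= r &
   [/\ AK A B K *m X + X *m (AK A B K)^T + e *: (X *m SK Qinf Rinf K *m X) + Wmx Bw = 0,
     lyap (AK A B K + e *: (X *m SK Qinf Rinf K))^T Y = - (Q2 + K^T *m R2 *m K) &
     R2 *m K + B^T *m Y + e *: (Rinf *m K *m X *m Y) = 0]].
Proof.
move=> r0; have [C C0 hC] := implicit_function _ sdf linear_L L_inj.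
have [_ sA] := sdA; have [_ sAcl] := sdAcl; have [_ sf] := sdf; have [_ sk] := sdk.
have [d1 d10 h1] := sA _ r0; have [d2 d20 h2] := sAcl _ r0; have [d3 d30 h3] := sk _ r0.
pose d := Num.min d1 (Num.min d2 d3).
have d0 : 0 < d by rewrite !lt_min d10 d20.
(* The residual of [z0] at parameter [e] is made at most [d / C], so the root stays within [d] of
   [z0]. *)
have [d4 d40 h4] := sf _ (divr_gt0 d0 C0).
apply: filterS2 hC (filterI h1 (filterI h2 (filterI h3 h4))).
move=> e [z fz dz] [{}h1 [{}h2 [{}h3 {}h4]]].
have z00 : `|z0 - z0| <= d4 by rewrite subrr normr0 ltW.
have zd : `|z - z0| <= d.
  have [+ _] := h4 _ _ z00 z00; rewrite subr0 => h.
  by rewrite (le_trans dz)// mulrC -ler_pdivlMr.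
move: zd; rewrite !le_min => /and3P[z1 z2 z3].
exists (kk z), (xx z), (yy z); split.
- by have [] := h3 _ _ z3 z3.
- by have [] := h1 _ _ z1 z1.
- by have [] := h2 _ _ z2 z2.
move: fz; rewrite /f -[X in _ = X]vsubmxK !linear0 => /eq_col_mx[hk].
rewrite -[X in _ = X]vsubmxK !linear0 => /eq_col_mx[hx hy].
by split=> //; apply/eqP; rewrite -addr_eq0 -/(Acl e z) -/(eqY e z) hy.
Qed.

End CoupledSystem.

(** * Choice of the threshold and conclusion *)

Theorem theorem4 (R : realType) (n m : nat) (A : 'M[R]_n) (B : 'M[R]_(n, m))
    (Bw : 'M[R]_n) (Q2 : 'M[R]_n) (R2 : 'M[R]_m) (Qinf : 'M[R]_n)
    (Rinf : 'M[R]_m) :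
  psd Q2 -> pd R2 -> pd Qinf -> pd Rinf ->
  stabilizable A B -> detectable (mx_sqrt Q2) A ->
  exists2 betabar : R, 0 < betabar &
    forall beta : R, betabar < beta ->
      inf [set hinf_norm A B Bw Qinf Rinf K | K in Kstab A B] < beta ->
      exists2 K : 'M[R]_(m, n), Kbeta A B Bw Qinf Rinf beta K &
        stationary A B Bw Q2 R2 Qinf Rinf beta K.
Proof.
move=> Q2p R2p Qp Rp stab det.
have [K0 [Y0 [hK0 Y0s stat0 Y0E]]] := lqr_riccati Q2p R2p stab det.
have [/(_ (- Wmx Bw))[X0 X0E] _] := sylvester_solve hK0 (hurwitz_tr hK0).
have [C C0 [d1 d10 hC]] := hinf_norm_bounded Bw Qinf Rinf hK0.
have [d2 d20 hd2] := hurwitz_open hK0.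
have r0 : 0 < Num.min d1 d2 by rewrite lt_min d10.
have := coupled_near Qinf Rinf R2p.1 (R2_unit R2p) Y0s hK0 stat0 X0E Y0E r0.
move=> /nbhs_normP[eta /= eta0 near_eta].
(* [C] dominates the H-infinity norm near [K0]; since [beta] exceeds both 1 and [eta^-1], so does
   its square, which gives [beta ^-2 < eta]. *)
exists (C + 1 + eta^-1) => [|beta hbeta _].
  by rewrite addr_gt0 ?invr_gt0// ltr_wpDl.
have eta_gt0 : 0 < eta^-1 by rewrite invr_gt0.
have beta1 : 1 < beta by lra.
have [|K [X [Y [KK0 KA KAcl [hX hY hs]]]]] := near_eta (beta ^-2).
  rewrite /= sub0r normrN ger0_norm ?invr_ge0 ?sqr_ge0//.
  rewrite invf_plt ?posrE ?exprn_gt0//; last by lra.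
  by rewrite expr2 (@lt_trans _ _ beta)//; [lra|rewrite ltr_pMr//; lra].
move: KK0 KA KAcl; rewrite !le_min => /andP[KK0 _] /andP[_ /hd2 hK] /andP[_ /hd2 hAcl].
exists K; first by split=> //; rewrite (le_lt_trans (hC _ KK0))//; lra.
apply: (@coupled_stationary _ _ _ _ _ _ _ _ _ _ _ R2p.1 (pd_psd Qp) (pd_psd Rp) K X Y) => //.
(* Symmetry of [Y] is not supplied by the implicit function theorem; it comes from uniqueness for
   its Lyapunov equation. *)
apply: (lyap_sym (hurwitz_tr hAcl) _ hY).
by rewrite linearN /= (cost_psd Q2p R2p K).1.
Qed.
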